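(* Let $W$, $\widehat P_n$, $\gamma_n$, $Y^n$ be as in the context, and let $n\ge1$. Put $$\mathfrak{A}_n(z)=-\gamma_n\left(\int_a^b\frac{\widehat P_n(t)W'(t)\widehat P_n^*(t)}{t-z}dt-\frac{\widehat P_n(t)W(t)\widehat P_n^*(t)}{t-z}\bigg|_{t=a}^{t=b}\right),$$ $$\mathfrak{B}_n(z)=-\left(\int_a^b\frac{\widehat P_n(t)W'(t)\widehat P_{n-1}^*(t)}{t-z}dt-\frac{\widehat P_n(t)W(t)\widehat P_{n-1}^*(t)}{t-z}\bigg|_{t=a}^{t=b}\right)\gamma_{n-1},$$ ($\mathfrak{A}_{n-1}$ being given by the first formula with $n-1$ in place of $n$). Provided that all the functions on the right-hand sides exist for $z\in\mathbb{C}\setminus[a,b]$ (the boundary terms being understood as limits), $Y^n$ satisfies $$\frac{d}{dz}Y^n(z)=\begin{pmatrix}-\mathfrak{B}_n(z)&-\frac1{2\pi i}\gamma_n^{-1}\mathfrak{A}_n(z)\\ 2\pi i\,\mathfrak{A}_{n-1}(z)\gamma_{n-1}&\mathfrak{B}_n^*(z)\end{pmatrix}Y^n(z),\qquad z\in\mathbb{C}\setminus[a,b].$$ In particular, $\gamma_n\mathfrak{A}_n^*(z)=\mathfrak{A}_n(z)\gamma_n$.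
   Context: Fix $N\ge1$ and a finite or infinite interval $(a,b)\subset\mathbb{R}$. The weight $W=(W_{ij}):(a,b)\to GL(N,\mathbb{R})$ is continuous and differentiable, $W(x)$ is (symmetric) positive definite for every $x$, and all entries of $W$ and $W'$ have finite moments of all orders. At every finite endpoint $c\in\{a,b\}$, $W(x)=|x-c|^{s_c}\widetilde W(x)$ with a scalar $s_c>-1$ and $\widetilde W$ bounded, continuous and non-vanishing at $c$. $A^*$ is the conjugate transpose; for functions of a complex variable $F^*(z):=(F(\bar z))^*$. $\widehat P_n$ is the monic matrix polynomial of degree $n$ (leading coefficient $I_N$) with $\int_a^b\widehat P_n W Q^*dx=0$ for all matrix polynomials $Q$ of degree $\le n-1$; $\gamma_n=\big(\int_a^b\widehat P_nW\widehat P_n^*dx\big)^{-1}$. $\mathcal{C}(F)(z)=\frac1{2\pi i}\int_a^b\frac{F(t)}{t-z}dt$. For $n\ge1$, in $N\times N$ blocks, $$Y^n(z)=\begin{pmatrix}\widehat P_n(z)&\mathcal{C}(\widehat P_nW)(z)\\ -2\pi i\gamma_{n-1}\widehat P_{n-1}(z)&-2\pi i\gamma_{n-1}\mathcal{C}(\widehat P_{n-1}W)(z)\end{pmatrix},\quad z\in\mathbb{C}\setminus[a,b]$$ (the unique solution of the Riemann–Hilbert problem associated with $W$). *)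

(* Defs.v *)
From HB Require Import structures.
From mathcomp Require Import all_boot all_order all_algebra.
From mathcomp Require Import all_classical all_reals all_analysis.
From mathcomp Require Import complex.

Set Implicit Arguments.
Unset Strict Implicit.
Unset Printing Implicit Defensive.

Import Order.TTheory GRing.Theory Num.Theory.
Import numFieldNormedType.Exports.

Local Open Scope classical_set_scope.
Local Open Scope ring_scope.
Local Open Scope complex_scope.
Local Open Scope sesquilinear_scope.

(* The interval (a, b) is given by extended real end points.  Matrices have
   size N.+1, so that the block size ranges over all integers >= 1 and
   'M_N.+1 is a nontrivial ring. *)

Definition ointerval (R : realType) (a b : \bar R) : set R :=
  [set x | (a < x%:E)%E /\ (x%:E < b)%E].

Definition cinterval (R : realType) (a b : \bar R) : set R :=
  [set x | (a <= x%:E)%E /\ (x%:E <= b)%E].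

(* C \ [a, b] *)
Definition slit_plane (R : realType) (a b : \bar R) : set R[i] :=
  [set z | ~ (complex.Im z = 0 /\ cinterval a b (complex.Re z))].

(* The filters of t --> a and t --> b from inside (a, b); the value of
   at_lower at +oo and of at_upper at -oo is irrelevant since a < b. *)
Definition at_lower (R : realType) (a : \bar R) : set_system R :=
  if a is r%:E then at_right r else ninfty_nbhs R.

Definition at_upper (R : realType) (b : \bar R) : set_system R :=
  if b is r%:E then at_left r else pinfty_nbhs R.

Definition cintegrable (R : realType) (D : set R) (f : R -> R[i]) : Prop :=
  (@lebesgue_measure R).-integrable D (fun x => (complex.Re (f x))%:E) /\
  (@lebesgue_measure R).-integrable D (fun x => (complex.Im (f x))%:E).

Definition cintegral (R : realType) (D : set R) (f : R -> R[i]) : R[i] :=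
  (\int[@lebesgue_measure R]_(x in D) complex.Re (f x))
  +i* (\int[@lebesgue_measure R]_(x in D) complex.Im (f x)).

Definition mxintegral (R : realType) (m n : nat) (D : set R)
    (F : R -> 'M[R[i]]_(m, n)) : 'M[R[i]]_(m, n) :=
  \matrix_(i, j) cintegral D (fun x => F x i j).

Definition mxlim (R : realType) (m n : nat) (FF : set_system R)
    (F : R -> 'M[R[i]]_(m, n)) : 'M[R[i]]_(m, n) :=
  \matrix_(i, j) lim ((F t i j : R[i]^o) @[t --> FF]).

Definition complexmx (R : realType) (m n : nat) (A : 'M[R]_(m, n)) :
    'M[R[i]]_(m, n) :=
  map_mx (fun x : R => x%:C) A.

(* F^*(z) := (F(conj z))^* *)
Definition star (R : realType) (m n : nat) (F : R[i] -> 'M[R[i]]_(m, n)) :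
    R[i] -> 'M[R[i]]_(n, m) :=
  fun z => (F (z^* )%R)^t*.

(* Near the finite end point c, W(x) = |x - c|^s Wt(x) with s > -1 and Wt
   bounded, continuous up to c and nonzero at c.  The factorization is local:
   Wt need not stay bounded near the other end point. *)
Definition regular_endpoint (R : realType) (N : nat) (a b : \bar R)
    (W : R -> 'M[R]_N.+1) (c : R) : Prop :=
  exists (s : R) (Wt : R -> 'M[R]_N.+1) (r : R),
    let D := cinterval a b `&` ball c r in
    [/\ -1 < s, 0 < r,
        forall x, ointerval a b x -> ball c r x ->
          W x = (`|x - c| `^ s) *: Wt x &
        [/\ [bounded Wt x | x in D], {within D, continuous Wt} & Wt c != 0]].

Definition posdefmx (R : realType) (N : nat) (A : 'M[R]_N) : Prop :=
  A^T = A /\ forall v : 'rV[R]_N, v != 0 -> 0 < (v *m A *m v^T) 0 0.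

Definition finite_moments (R : realType) (N : nat) (a b : \bar R)
    (F : R -> 'M[R]_N) : Prop :=
  forall (k : nat) (i j : 'I_N),
    (@lebesgue_measure R).-integrable (ointerval a b)
      (fun x => (x ^+ k * F x i j)%:E).

Record is_weight (R : realType) (N : nat) (a b : \bar R)
    (W : R -> 'M[R]_N.+1) : Prop := IsWeight {
  weight_continuous : forall x, ointerval a b x -> {for x, continuous W};
  weight_derivable : forall x : R, ointerval a b x -> derivable W x 1;
  weight_unit : forall x, ointerval a b x -> W x \in unitmx;
  weight_posdef : forall x, ointerval a b x -> posdefmx (W x);
  weight_moments : finite_moments a b W;
  weight_deriv_moments : finite_moments a b (derive1 W);
  weight_endpoint :
    forall c : R, c%:E = a \/ c%:E = b -> regular_endpoint a b W c
}.

(* A matrix polynomial with coefficients in 'M_N.+1 is evaluated at a scalar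
   through the corresponding scalar matrix. *)
Definition mxeval (R : realType) (N : nat) (p : {poly 'M[R[i]]_N.+1})
    (z : R[i]) : 'M[R[i]]_N.+1 :=
  p.[z%:M].

(* The integral of p W q^* over (a, b) *)
Definition weight_form (R : realType) (N : nat) (a b : \bar R)
    (W : R -> 'M[R]_N.+1) (p q : {poly 'M[R[i]]_N.+1}) : 'M[R[i]]_N.+1 :=
  mxintegral (ointerval a b)
    (fun t => mxeval p t%:C *m complexmx (W t) *m (mxeval q t%:C)^t*).

Definition is_monic_orthogonal (R : realType) (N : nat) (a b : \bar R)
    (W : R -> 'M[R]_N.+1) (n : nat) (p : {poly 'M[R[i]]_N.+1}) : Prop :=
  [/\ p \is monic, size p = n.+1 &
      forall q : {poly 'M[R[i]]_N.+1},
        (size q <= n)%N -> weight_form a b W p q = 0].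

Definition gamma (R : realType) (N : nat) (a b : \bar R)
    (W : R -> 'M[R]_N.+1) (P : nat -> {poly 'M[R[i]]_N.+1}) (n : nat) :
    'M[R[i]]_N.+1 :=
  invmx (weight_form a b W (P n) (P n)).

Definition two_pi_i (R : realType) : R[i] := (2 * pi)%:C * 'i.

Definition cauchy_transform (R : realType) (m n : nat) (a b : \bar R)
    (F : R -> 'M[R[i]]_(m, n)) (z : R[i]) : 'M[R[i]]_(m, n) :=
  (two_pi_i R)^-1 *:
    mxintegral (ointerval a b) (fun t => (t%:C - z)^-1 *: F t).

Definition Ymx (R : realType) (N : nat) (a b : \bar R)
    (W : R -> 'M[R]_N.+1) (P : nat -> {poly 'M[R[i]]_N.+1}) (n : nat)
    (z : R[i]) : 'M[R[i]]_(N.+1 + N.+1) :=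
  let PW k t := mxeval (P k) t%:C *m complexmx (W t) in
  let g := gamma a b W P n.-1 in
  block_mx
    (mxeval (P n) z)
    (cauchy_transform a b (PW n) z)
    (- two_pi_i R *: (g *m mxeval (P n.-1) z))
    (- two_pi_i R *: (g *m cauchy_transform a b (PW n.-1) z)).

(* p(t) V(t) q^*(t) / (t - z) *)
Definition cauchy_integrand (R : realType) (N : nat) (V : R -> 'M[R]_N.+1)
    (p q : {poly 'M[R[i]]_N.+1}) (z : R[i]) (t : R) : 'M[R[i]]_N.+1 :=
  (t%:C - z)^-1 *: (mxeval p t%:C *m complexmx (V t) *m (mxeval q t%:C)^t*).

(* The common bracket of the formulas for frakA and frakB: an integral against
   W' minus a boundary term. *)
Definition bracket (R : realType) (N : nat) (a b : \bar R)
    (W : R -> 'M[R]_N.+1) (p q : {poly 'M[R[i]]_N.+1}) (z : R[i]) :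
    'M[R[i]]_N.+1 :=
  mxintegral (ointerval a b) (cauchy_integrand (derive1 W) p q z)
  - (mxlim (at_upper b) (cauchy_integrand W p q z)
     - mxlim (at_lower a) (cauchy_integrand W p q z)).

(* The integral and the limits that define bracket exist off [a, b]. *)
Definition bracket_exists (R : realType) (N : nat) (a b : \bar R)
    (W : R -> 'M[R]_N.+1) (p q : {poly 'M[R[i]]_N.+1}) : Prop :=
  forall z, slit_plane a b z -> forall i j,
    [/\ cintegrable (ointerval a b)
          (fun t => cauchy_integrand (derive1 W) p q z t i j),
        cvg ((cauchy_integrand W p q z t i j : R[i]^o) @[t --> at_upper b]) &
        cvg ((cauchy_integrand W p q z t i j : R[i]^o) @[t --> at_lower a])].

Definition frakA (R : realType) (N : nat) (a b : \bar R)
    (W : R -> 'M[R]_N.+1) (P : nat -> {poly 'M[R[i]]_N.+1}) (n : nat)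
    (z : R[i]) : 'M[R[i]]_N.+1 :=
  - (gamma a b W P n *m bracket a b W (P n) (P n) z).

Definition frakB (R : realType) (N : nat) (a b : \bar R)
    (W : R -> 'M[R]_N.+1) (P : nat -> {poly 'M[R[i]]_N.+1}) (n : nat)
    (z : R[i]) : 'M[R[i]]_N.+1 :=
  - (bracket a b W (P n) (P n.-1) z *m gamma a b W P n.-1).

Definition ladder_mx (R : realType) (N : nat) (a b : \bar R)
    (W : R -> 'M[R]_N.+1) (P : nat -> {poly 'M[R[i]]_N.+1}) (n : nat)
    (z : R[i]) : 'M[R[i]]_(N.+1 + N.+1) :=
  block_mx
    (- frakB a b W P n z)
    (- (two_pi_i R)^-1 *: (invmx (gamma a b W P n) *m frakA a b W P n z))
    (two_pi_i R *: (frakA a b W P n.-1 z *m gamma a b W P n.-1))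
    (star (frakB a b W P n) z).

(* Main.v *)
Require Import Defs.
From HB Require Import structures.
From mathcomp Require Import all_boot all_order all_algebra.
From mathcomp Require Import all_classical all_reals all_analysis.
From mathcomp Require Import measurable_realfun.
From mathcomp Require Import complex ring lra.

Set Implicit Arguments.
Unset Strict Implicit.
Unset Printing Implicit Defensive.

Import Order.TTheory GRing.Theory Num.Theory.
Import numFieldNormedType.Exports.

Local Open Scope classical_set_scope.
Local Open Scope ring_scope.

(* With x the integration variable, write <p, q> for the integral of p W q^*,
   h_k = <P_k, P_k> and, for z off [a, b], br(p, q) for the functional
   - int p' W q^*/(x - z) - int p W (q^* )'/(x - z) + int p W q^*/(x - z)^2.
   Integrating by parts identifies br(p, q) with the bracket of the theorem;
   since W' is only known to exist and to be integrable, this uses the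
   fundamental theorem of calculus in its Lebesgue form.  From
     br(p, X q) = z br(p, q) - <p', q> - <p, q'>
   and the three-term recurrence, a Christoffel-Darboux telescoping gives, for
   m = n - 1 or n, the polynomial identity
     br(P_m, P_(n-1)) g P_n - br(P_m, P_n) g P_(n-1)
       = (X - z) sum_(k < n) br(P_m, P_k) h_k^-1 P_k + P_m',  g = h_(n-1)^-1.
   Its value at z is the first block column of the differential equation, and
   integrating it against W/(x - z) gives the second one. *)

(** * Hankel forms over a ring with an anti-involution *)

(** The telescoping runs through br(P_m, P_k) for every k < n, whereas existence of the bracket is
    assumed for three pairs only. This is why br is defined by moments of W/(x - z) and W/(x - z)^2,
    which always exist off [a, b], and is compared with the bracket of the theorem just at those
    pairs; the fourth value, br(P_(n-1), P_n), comes from the pair P_n, P_(n-1) by conjugation.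
    Since x is real, each of these integrals sees the powers of x in p and q^* only through their
    sum: it is a Hankel form in a sequence of matrix moments. Multiplication by X then moves freely
    from one argument to the other, and 1/(x - z) enters the algebra only via M1_(k+1) = z M1_k +
    M0_k and M2_(k+1) = z M2_k + M1_k. The ladder identities thus live in a ring with an
    anti-involution and a central z; analysis has to supply the moments, the inverses of h_k, the
    integration by parts and the derivative of Y. The factor X - z serves both columns: it vanishes
    at z, and it cancels the pole of W/(x - z), leaving int P_k W, which is zero unless k = 0. *)

Section HankelForm.
Context (A : unitRingType) (star : {additive A -> A}).
Hypothesis starM : forall x y, star (x * y) = star y * star x.
Hypothesis starK : involutive star.
Implicit Types (M : nat -> A) (p q : {poly A}) (c : A).

Lemma star1 : star 1 = 1.
Proof. by rewrite -[LHS]mulr1 -{2}(starK 1) -starM mulr1 starK. Qed.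

(** With [M k] the integral of t^k V(t), this is the integral of p V q^*, because for real t the
    powers t^i from p and t^j from q^* merge into t^(i+j). *)
Definition hankel_form M p q : A :=
  \sum_(i < size p) \sum_(j < size q) p`_i * M (i + j)%N * star q`_j.

Lemma hankel_form_widen M p q m n : (size p <= m)%N -> (size q <= n)%N ->
  hankel_form M p q =
  \sum_(i < m) \sum_(j < n) p`_i * M (i + j)%N * star q`_j.
Proof.
move=> pm qn; rewrite /hankel_form (big_ord_widen m
  (fun i => \sum_(j < size q) p`_i * M (i + j)%N * star q`_j)) //.
rewrite [RHS](bigID (fun i : 'I_m => (i < size p)%N)) /=.
rewrite [X in _ = _ + X]big1; last first.
  move=> i; rewrite -leqNgt => /(nth_default 0) ->.
  by rewrite big1 // => j _; rewrite !mul0r.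
rewrite addr0; apply: eq_bigr => i _.
rewrite (big_ord_widen n (fun j => p`_i * M (i + j)%N * star q`_j)) //.
rewrite [RHS](bigID (fun j : 'I_n => (j < size q)%N)) /=.
rewrite [X in _ = _ + X]big1 ?addr0 // => j.
by rewrite -leqNgt => /(nth_default 0) ->; rewrite raddf0 mulr0.
Qed.

Lemma hankel_formDl M p1 p2 q :
  hankel_form M (p1 + p2) q = hankel_form M p1 q + hankel_form M p2 q.
Proof.
set m := maxn (size p1) (size p2).
have s1 : (size p1 <= m)%N by rewrite leq_maxl.
have s2 : (size p2 <= m)%N by rewrite leq_maxr.
have s3 : (size (p1 + p2)%R <= m)%N by exact: size_polyD.
have H p : (size p <= m)%N -> _ := fun s =>
  hankel_form_widen M s (leqnn (size q)).
rewrite !H // -big_split /=.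
apply: eq_bigr => i _; rewrite -big_split /=; apply: eq_bigr => j _.
by rewrite coefD !mulrDl.
Qed.

Lemma hankel_formZl M c p q :
  hankel_form M (c *: p) q = c * hankel_form M p q.
Proof.
rewrite (hankel_form_widen M (size_scale_leq c p) (leqnn (size q))) mulr_sumr.
apply: eq_bigr => i _; rewrite mulr_sumr; apply: eq_bigr => j _.
by rewrite coefZ !mulrA.
Qed.

Lemma hankel_formXl M p q :
  hankel_form M (p * 'X) q = hankel_form (fun k => M k.+1) p q.
Proof.
have s : (size (p * 'X)%R <= (size p).+1)%N.
  by rewrite (leq_trans (size_polyMleq _ _)) // size_polyX addn2.
rewrite (hankel_form_widen M s (leqnn (size q))) big_ord_recl /= [X in X +
  _]big1.
  rewrite add0r; apply: eq_bigr => i _; apply: eq_bigr => j _.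
  by rewrite coefMX /= /bump leq0n add1n.
by move=> j _; rewrite coefMX !mul0r.
Qed.

Lemma star_hankel_form M p q :
  star (hankel_form M p q) = hankel_form (star \o M) q p.
Proof.
rewrite raddf_sum /= [RHS]exchange_big; apply: eq_bigr => i _.
rewrite raddf_sum; apply: eq_bigr => j _ /=.
by rewrite !starM starK mulrA addnC.
Qed.

Lemma hankel_form0l M q : hankel_form M 0 q = 0.
Proof. by rewrite /hankel_form size_poly0 big_ord0. Qed.

Lemma hankel_form0r M p : hankel_form M p 0 = 0.
Proof. by apply: big1 => i _; rewrite size_poly0 big_ord0. Qed.

Lemma eq_hankel_form M1 M2 : M1 =1 M2 -> hankel_form M1 =2 hankel_form M2.
Proof.
by move=> e p q; apply: eq_bigr => i _; apply: eq_bigr => j _; rewrite e.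
Qed.

Lemma hankel_formDm M M' p q :
  hankel_form (fun k => M k + M' k) p q =
    hankel_form M p q + hankel_form M' p q.
Proof.
rewrite -big_split /=; apply: eq_bigr => i _; rewrite -big_split /=.
by apply: eq_bigr => j _; rewrite mulrDr mulrDl.
Qed.

Lemma hankel_formNm M p q :
  hankel_form (fun k => - M k) p q = - hankel_form M p q.
Proof.
rewrite -sumrN; apply: eq_bigr => i _; rewrite -sumrN.
by apply: eq_bigr => j _; rewrite mulrN mulNr.
Qed.

(* The weight i + j of the (i, j) term of a Hankel form splits as a derivative
   of either argument. *)
Lemma hankel_form_deriv M p q : hankel_form (fun k => M k.-1 *+ k) p q =
  hankel_form M p^`() q + hankel_form M p q^`().
Proof.
have derivl p' q' : hankel_form M p'^`() q' =
    \sum_(i < size p') \sum_(j < size q') p'`_i * (M (i + j).-1 *+ i) * star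
      q'`_j.
  have sd : (size p'^`() <= (size p').-1)%N by exact: size_poly.
  rewrite (hankel_form_widen M sd (leqnn _)).
  case: (size p') => [|m] /=; first by rewrite !big_ord0.
  rewrite [RHS]big_ord_recl /= [X in _ = X + _]big1 ?add0r => [|j _];
    last first.
    by rewrite mulr0n mulr0 mul0r.
  apply: eq_bigr => i _; apply: eq_bigr => j _.
  by rewrite coef_deriv /= /bump leq0n add1n mulrnAl mulrnAr.
have derivr p' q' : hankel_form M p' q'^`() =
    \sum_(i < size p') \sum_(j < size q') p'`_i * (M (i + j).-1 *+ j) * star
      q'`_j.
  have sd : (size q'^`() <= (size q').-1)%N by exact: size_poly.
  rewrite (hankel_form_widen M (leqnn _) sd); apply: eq_bigr => i _.
  case: (size q') => [|m] /=; first by rewrite !big_ord0.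
  rewrite [RHS]big_ord_recl /= mulr0n mulr0 mul0r add0r.
  apply: eq_bigr => j _.
  by rewrite coef_deriv /= /bump leq0n add1n addnS raddfMn mulrnAr mulrnAr
    mulrnAl.
rewrite derivl derivr -big_split /=; apply: eq_bigr => i _.
rewrite -big_split /=; apply: eq_bigr => j _.
by rewrite -mulrDl -mulrDr -mulrnDr.
Qed.

(** Turns every law for the left argument into its mirror image for the right one, with starred
    moments in between. *)
Lemma star_hankel_formK M p q :
  star (hankel_form (star \o M) q p) = hankel_form M p q.
Proof. by rewrite -star_hankel_form starK. Qed.

Lemma hankel_formDr M p q1 q2 :
  hankel_form M p (q1 + q2) = hankel_form M p q1 + hankel_form M p q2.
Proof. by rewrite -!(star_hankel_formK M) hankel_formDl raddfD. Qed.

Lemma hankel_formZr M c p q :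
  hankel_form M p (c *: q) = hankel_form M p q * star c.
Proof. by rewrite -!(star_hankel_formK M) hankel_formZl starM. Qed.

Lemma hankel_formXr M p q :
  hankel_form M p (q * 'X) = hankel_form (fun k => M k.+1) p q.
Proof.
by rewrite -!(star_hankel_formK M) hankel_formXl -[in RHS]star_hankel_formK.
Qed.

Lemma hankel_formX M p q :
  hankel_form M (p * 'X) q = hankel_form M p (q * 'X).
Proof. by rewrite hankel_formXl hankel_formXr. Qed.

Fact hankel_form_is_zmod_morphism M p : zmod_morphism (hankel_form M p).
Proof.
move=> q1 q2; rewrite hankel_formDr -scaleN1r hankel_formZr raddfN.
by rewrite star1 mulrN1.
Qed.

HB.instance Definition _ M p := GRing.isZmodMorphism.Build _ _ (hankel_form M p)
  (hankel_form_is_zmod_morphism M p).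

Lemma hankel_formDM (z : A) (M M' : nat -> A) p q : (forall x, z * x = x * z) ->
  hankel_form (fun k => z * M k + M' k) p q =
  z * hankel_form M p q + hankel_form M' p q.
Proof.
move=> zC; rewrite mulr_sumr -big_split /=; apply: eq_bigr => i _.
rewrite mulr_sumr -big_split /=; apply: eq_bigr => j _.
by rewrite mulrDr mulrDl !mulrA zC.
Qed.

(* When [M1] and [M2] are the moments of W/(t - z) and W/(t - z)^2, this is
   what integrating by parts makes of the bracket of the theorem. *)
Definition hankel_bracket (M1 M2 : nat -> A) p q : A :=
  hankel_form M2 p q - (hankel_form M1 p^`() q + hankel_form M1 p q^`()).

Lemma star_hankel_bracket M1 M2 p q : star (hankel_bracket M1 M2 p q) =
  hankel_bracket (star \o M1) (star \o M2) q p.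
Proof.
by rewrite /hankel_bracket raddfB raddfD /= !star_hankel_form
  [X in _ - X = _]addrC.
Qed.

(** * Expansion in orthogonal polynomials, three-term recurrence, Christoffel-Darboux *)

Section Orthogonal.
Variables (M0 : nat -> A) (P : nat -> {poly A}).
Hypothesis M0_star : forall k, star (M0 k) = M0 k.
Hypothesis P_monic : forall k, P k \is monic.
Hypothesis size_P : forall k, size (P k) = k.+1.
Hypothesis P_orthogonal :
  forall k q, (size q <= k)%N -> hankel_form M0 (P k) q = 0.
Local Notation "<< p , q >>" := (hankel_form M0 p q).
Local Notation h k := << P k, P k >>.
Local Notation g k := (h k)^-1.
Hypothesis h_unit : forall k, h k \is a GRing.unit.

Lemma hankel_form_herm p q : star << p, q >> = << q, p >>.
Proof. by rewrite star_hankel_form; apply: eq_hankel_form => k /=. Qed.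

Lemma P_orthogonalr k q : (size q <= k)%N -> << q, P k >> = 0.
Proof. by move=> /P_orthogonal qk; rewrite -hankel_form_herm qk raddf0. Qed.

Lemma star_h k : star (h k) = h k. Proof. exact: hankel_form_herm. Qed.

Lemma star_inv_h k : star (g k) = g k.
Proof.
by apply: (mulrI (h_unit k));
  rewrite -{1}(star_h k) -starM mulVr // mulrV // star1.
Qed.

Lemma size_P_cancel n p : (size p <= n.+1)%N ->
  (size (p - p`_n *: P n)%R <= n)%N.
Proof.
move=> pn; apply/leq_sizeP => j; rewrite leq_eqVlt => /predU1P[<-|nj].
  have := monicP (P_monic n); rewrite lead_coefE size_P /= => Pn1.
  by rewrite coefB coefZ Pn1 mulr1 subrr.
rewrite coefB coefZ [p`_j]nth_default ?(leq_trans pn) //.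
by rewrite [(P n)`_j]nth_default ?size_P // mulr0 subr0.
Qed.

(** The top coefficient is split off with the monic [P n]. It equals <<p, P n>> h_n^-1 because the
    remainder, of lower degree, is orthogonal to [P n]; conversely [P n] does not contribute to the
    lower coefficients. *)
Lemma orthogonal_expansion n p : (size p <= n)%N ->
  p = \sum_(k < n) (<< p, P k >> * g k) *: P k.
Proof.
elim: n p => [p|n IHn p pn].
  by rewrite size_poly_leq0 => /eqP ->; rewrite big_ord0.
have := IHn _ (size_P_cancel pn).
set r := p - _ => rE; have sr : (size r <= n)%N by exact: size_P_cancel.
have pE : p = r + p`_n *: P n by rewrite subrK.
have cE : p`_n = << p, P n >> * g n.
  by rewrite [in RHS]pE hankel_formDl hankel_formZl P_orthogonalr //
    add0r mulrK.
rewrite big_ord_recr /= -cE {1}pE {1}rE; congr (_ + _).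
apply: eq_bigr => k _; rewrite [in RHS]pE hankel_formDl hankel_formZl.
by rewrite (@P_orthogonal n) ?size_P // mulr0 addr0.
Qed.

Lemma size_recurrence k : (size (P k * 'X - P k.+1)%R <= k.+1)%N.
Proof.
have -> : P k * 'X - P k.+1 = - (P k.+1 - (P k.+1)`_k.+1 *: P k.+1)
    + (P k * 'X - (P k * 'X)`_k.+1 *: P k.+1).
  rewrite coefMX /=.
  have := monicP (P_monic k); rewrite lead_coefE size_P /= => ->.
  have := monicP (P_monic k.+1); rewrite lead_coefE size_P /= => ->.
  by rewrite scale1r subrr oppr0 add0r.
rewrite (leq_trans (size_polyD _ _)) // size_polyN geq_max !size_P_cancel //.
  by rewrite (leq_trans (size_polyMleq _ _)) // size_polyX size_P addn2.
by rewrite size_P.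
Qed.

Lemma hankel_form_recurrence k : << P k * 'X, P k.+1 >> = h k.+1.
Proof.
rewrite -[P k * 'X](subrK (P k.+1)) hankel_formDl P_orthogonalr ?add0r //.
exact: size_recurrence.
Qed.

Lemma recurrence_expansion k :
  P k * 'X = P k.+1 + \sum_(j < k.+1) (<< P k * 'X, P j >> * g j) *: P j.
Proof.
rewrite -[LHS](subrK (P k.+1)) addrC.
rewrite {1}(orthogonal_expansion (size_recurrence k)).
congr (_ + _); apply: eq_bigr => j _; rewrite hankel_formDl -scaleN1r.
by rewrite hankel_formZl (@P_orthogonal k.+1) ?size_P // mulr0 addr0.
Qed.

Lemma recurrence0 : P 0 * 'X = P 1 + (<< P 0 * 'X, P 0 >> * g 0) *: P 0.
Proof. by rewrite [LHS]recurrence_expansion big_ord1. Qed.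

(** Moving 'X to the other argument, <<X P_(k+1), P_j>> = <<P_(k+1), X P_j>> vanishes for j < k by
    degree, and for j = k it is h_(k+1) since X P_k is monic of degree k + 1. *)
Lemma three_term_recurrence k :
  P k.+1 * 'X = P k.+2 + ((h k.+1 * g k) *: P k
                + (<< P k.+1 * 'X, P k.+1 >> * g k.+1) *: P k.+1).
Proof.
rewrite [LHS]recurrence_expansion !big_ord_recr /= big1 ?add0r => [|i _].
  congr (_ + (_ *: _ + _)); congr (_ * _).
  by rewrite hankel_formX -hankel_form_herm hankel_form_recurrence star_h.
rewrite hankel_formX (@P_orthogonal k.+1) ?mul0r ?scale0r //.
by rewrite (leq_trans (size_polyMleq _ _)) // size_polyX size_P addn2 /= ltnS.
Qed.

Lemma star_recurrence_coef k :
  star (<< P k * 'X, P k >> * g k) = g k * << P k * 'X, P k >>.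
Proof. by rewrite starM star_inv_h hankel_form_herm hankel_formX. Qed.

(** The functional [l] takes the place of evaluation at a second point. In the inductive step the
    recurrence is applied inside and outside [l]: the diagonal terms cancel because
    [star_recurrence_coef] makes both equal to g_k <<X P_k, P_k>> g_k, and both descending
    coefficients reduce to h_n^-1, which is what the induction hypothesis absorbs. *)
Lemma christoffel_darboux (l : {additive {poly A} -> A}) :
  (forall c q, l (c *: q) = l q * star c) -> forall n,
  (l (P n) * g n) *: P n.+1 - (l (P n.+1) * g n) *: P n =
  \sum_(k < n.+1) ((l (P k) * g k) *: (P k * 'X) - (l (P k * 'X) * g k) *: P k).
Proof.
move=> lZ; elim=> [|n IHn].
  rewrite big_ord1 recurrence0 !raddfD /= lZ star_recurrence_coef mulrDl.
  rewrite scalerDl !scalerA !mulrA opprD addrACA subrr addr0 //.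
rewrite big_ord_recr /= -IHn three_term_recurrence !raddfD /= !lZ.
rewrite star_recurrence_coef starM star_h star_inv_h.
rewrite !mulrDl !scalerDl !scalerA !mulrA.
rewrite !mulrVK // !mulrK //.
set a1 := (_ * g n.+1) *: P n.+2.
set b1 := (_ * g n) *: P n.+1; set b2 := (_ * g n) *: P n.
rewrite opprD [X in _ = _ + X]addrACA [X in _ = _ + (_ + (_ + X))]opprD.
by rewrite [X in _ = _ + (_ + X)]addrACA subrr addr0 addrCA -(opprB b1 b2)
  subrr addr0.
Qed.

(** * The ladder identities *)

Section Ladder.
Variables (z : A) (M1 M2 : nat -> A).
Hypothesis z_central : forall x, z * x = x * z.
Hypothesis M1S : forall k, M1 k.+1 = z * M1 k + M0 k.
Hypothesis M2S : forall k, M2 k.+1 = z * M2 k + M1 k.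

Local Notation br := (hankel_bracket M1 M2).

(** Shifting [M2] produces an extra [M1] form of p and q, which cancels the one coming from the
    summand q of (q X)' = q' X + q. Only the [M0] terms produced by shifting [M1] are left over. *)
Lemma hankel_bracketX p q : br p (q * 'X) =
  z * br p q - (<< p^`(), q >> + << p, q^`() >>).
Proof.
have E1 r s : hankel_form M1 r (s * 'X) = z * hankel_form M1 r s + << r, s >>.
  by rewrite hankel_formXr -hankel_formDM //; apply: eq_hankel_form.
have E2 r s : hankel_form M2 r (s * 'X) =
    z * hankel_form M2 r s + hankel_form M1 r s.
  by rewrite hankel_formXr -hankel_formDM //; apply: eq_hankel_form.
rewrite /hankel_bracket derivM derivX mulr1 hankel_formDr !E1 E2.
set x0 := << _, _ >>; set x1 := hankel_form M1 _ _; set x2 := << _, _ >>.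
set x3 := hankel_form M1 _ _; set x4 := hankel_form M1 _ _.
rewrite mulrBr mulrDr.
rewrite [X in _ - X]addrA (addrACA (z * x3)) opprD [LHS]addrACA.
by rewrite subrr addr0 opprD addrA.
Qed.

Fact hankel_bracket_is_zmod_morphism p : zmod_morphism (br p).
Proof.
move=> q1 q2; rewrite /hankel_bracket derivB !raddfB /=.
rewrite [X in _ - X = _]addrACA -[X in _ - (_ + X) = _]opprD !opprB.
by rewrite [X in _ + X = _]addrC [LHS]addrACA opprK.
Qed.

HB.instance Definition _ p := GRing.isZmodMorphism.Build _ _ (br p)
  (hankel_bracket_is_zmod_morphism p).

Lemma hankel_bracketZ p c q :
  br p (c *: q) = br p q * star c.
Proof. by rewrite /hankel_bracket derivZ !hankel_formZr !mulrDl mulNr mulrDl.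
  Qed.

(** Christoffel-Darboux for l = br(P_m, .); here [n] stands for the n - 1 of the ladder equation.
    The two bounds on m have separate roles: m <= n + 1 lets P_m' be expanded in P_0, ..., P_n, and
    n <= m makes <<P_m, P_k'>> vanish for k <= n, so that the [M0] terms of [hankel_bracketX] add up
    to P_m' exactly. *)
Lemma ladder_poly n m : (n <= m <= n.+1)%N ->
  (br (P m) (P n) * g n) *: P n.+1 -
    (br (P m) (P n.+1) * g n) *: P n =
  \sum_(k < n.+1) (br (P m) (P k) * g k) *: (P k * 'X - z *: P k)
    + (P m)^`().
Proof.
move=> /andP[nm mn]; rewrite (christoffel_darboux (hankel_bracketZ _)).
rewrite [(P m)^`() in RHS](@orthogonal_expansion n.+1); last first.
  by rewrite -ltnS (leq_trans (lt_size_deriv _)) ?monic_neq0 ?size_P.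
rewrite -big_split /=; apply: eq_bigr => k _.
rewrite hankel_bracketX (@P_orthogonal m _^`()); last first.
  rewrite -ltnS (leq_trans (lt_size_deriv _)) // ?monic_neq0 // size_P.
  by rewrite ltnS (leq_trans _ nm) // -ltnS.
rewrite addr0 scalerBr -addrA; congr (_ + _).
by rewrite mulrBl scalerBl opprB addrC scalerA z_central -!mulrA z_central.
Qed.

Lemma ladder_horner n m : (n <= m <= n.+1)%N ->
  (P m)^`().[z] = br (P m) (P n) * g n * (P n.+1).[z] -
    br (P m) (P n.+1) * g n * (P n).[z].
Proof.
move=> /ladder_poly/(congr1 (horner^~ z)); rewrite !hornerE.
(* Evaluation over a noncommutative ring is not multiplicative; it still kills P_k X - z P_k since z
   is central. *)
rewrite horner_sum big1 ?add0r // => k _.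
by rewrite hornerZ hornerD hornerMX hornerN hornerZ z_central subrr mulr0.
Qed.

(** Pairing X P_k - z P_k with 1 through [M1] gives <<P_k, 1>>, so only k = 0 survives, where P_0 =
    1 and h_0 cancels its inverse. What remains is br(P_m, 1) plus the [M1] form of P_m' and 1, and
    that is the [M2] form by the definition of the bracket. *)
Lemma ladder_cauchy n m : (n <= m <= n.+1)%N ->
  hankel_form M2 (P m) 1 =
  br (P m) (P n) * g n * hankel_form M1 (P n.+1) 1 -
    br (P m) (P n.+1) * g n * hankel_form M1 (P n) 1.
Proof.
move=> /ladder_poly; set r := _ - _ => rE.
have P0 : P 0 = 1.
  have := monicP (P_monic 0); rewrite lead_coefE size_P /= => P00.
  by rewrite [P 0]size1_polyC ?size_P // P00.
rewrite -!hankel_formZl -mulN1r -hankel_formZl -hankel_formDl scaleN1r -/r rE.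
rewrite hankel_formDl.
rewrite (big_morph (hankel_form M1 ^~ 1) (fun p q => hankel_formDl M1 p q 1)
  (hankel_form0l M1 1)).
have shift k : hankel_form M1 (P k * 'X - z *: P k) 1 = << P k, 1 >>.
  rewrite hankel_formDl -scaleN1r !hankel_formZl mulN1r hankel_formXl.
  rewrite (eq_hankel_form M1S) hankel_formDM //.
  by rewrite addrAC subrr add0r.
under eq_bigr do rewrite hankel_formZl shift.
rewrite big_ord_recl big1 ?addr0 => [|k _]; last first.
  by rewrite (@P_orthogonal (lift ord0 k) 1) ?mulr0 ?size_poly1.
have {}P0 : P (@ord0 n) = 1 by [].
have -> : << P (@ord0 n), 1 >> = h (@ord0 n) by rewrite P0.
rewrite mulrVK // P0 /hankel_bracket derivC raddf0 addr0.
by rewrite subrK.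
Qed.
End Ladder.
End Orthogonal.
End HankelForm.

(** * The fundamental theorem of calculus for everywhere differentiable functions *)

Section FTC_derivable.
Context {R : realType}.
Notation mu := (@lebesgue_measure R).

(* Countably many open neighbourhoods of Z of small total measure; near a
   point of Z any number of them overlap. *)
Lemma null_set_steep (Z : set R) (e : R) : mu.-negligible Z -> 0 < e ->
  exists G : R -> R, [/\ {homo G : x y / x <= y}, (forall x, 0 <= G x <= e) &
    forall x (n : nat), Z x -> \forall t \near x^'+,
      n%:R * (t - x) <= G t - G x].
Proof.
move=> /negligible_outer_measure Z0 e0.
have e2_gt0 k : 0 < e / (2 ^ k.+1)%:R :> R by rewrite divr_gt0.
pose U k := projT1 (cid (outer_measure_open_le Z (e2_gt0 k))).
have oU k : open (U k) by rewrite /U; case: cid => x /= [].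
have ZU k : Z `<=` U k by rewrite /U; case: cid => x /= [].
have mU k : (mu (U k) <= (e / (2 ^ k.+1)%:R)%:E)%E.
  by rewrite /U; case: cid => x /= [_ _]; rewrite Z0 add0e.
have MU k : measurable (U k) by exact: open_measurable.
have MUD k D : measurable D -> measurable (U k `&` D).
  by move=> mD; exact: measurableI.
pose s (D : set R) := (\sum_(k <oo) mu (U k `&` D))%E.
have s_ge0 D : (0 <= s D)%E by exact: nneseries_ge0.
have s_le D : measurable D -> (s D <= e%:E)%E.
  move=> mD; apply: (le_trans _ (epsilon_trick0 xpredT (ltW e0))).
  apply: lee_nneseries => // k _; apply: le_trans (mU k).
  by apply: le_measure; rewrite ?inE //; [exact: MUD | exact: MU].
have s_fin D : measurable D -> s D \is a fin_num.
  by move=> mD; rewrite ge0_fin_numE // (le_lt_trans (s_le _ mD)) ?ltry.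
have sU x y : x <= y ->
    s `]-oo, y]%classic = (s `]-oo, x]%classic + s `]x, y]%classic)%E.
  move=> xy; rewrite /s -nneseriesD //; apply: eq_eseriesr => k _.
  rewrite -measureU; try exact: MUD.
    rewrite -setIUr; congr (mu (_ `&` _)).
    by rewrite -itv_bndbnd_setU // bnd_simp.
  rewrite setIACA setIid; apply/seteqP; split => // t [_] /= [].
  by rewrite !in_itv /= => tx /andP[] /lt_le_trans /(_ tx); rewrite ltxx.
(* The bounds e / 2^(k+1) sum to e, so [G], which adds up the measures of the parts of all [U k] to
   the left of x, is real-valued and at most e. *)
pose G x := fine (s `]-oo, x]%classic).
have GE x y : x <= y -> G y - G x = fine (s `]x, y]%classic).
  by move=> xy; rewrite /G (sU x y) // fineD ?s_fin // addrC addKr.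
exists G; split.
- by move=> x y xy; rewrite -subr_ge0 GE // fine_ge0.
- move=> x; rewrite fine_ge0 //=.
  by rewrite -lee_fin fineK ?s_le ?s_fin.
- move=> x n Zx.
  have : \forall t \near x, forall k, (k < n)%N -> U k t.
    have : \forall t \near x, forall k : 'I_n, U k t.
      apply: (@filter_forall R 'I_n U (nbhs x)) => k.
      by apply: open_nbhs_nbhs; split; [exact: oU | exact: ZU].
    by apply: filterS => t tU k kn; exact: (tU (Ordinal kn)).
  move=> /nbhs_ballP[r /= r0 rU].
  near=> t.
  have xt : x < t by near: t; exact: nbhs_right_gt.
  rewrite (GE _ _ (ltW xt)) -lee_fin fineK ?s_fin //.
  apply: le_trans (nneseries_lim_ge n _) => //.
  rewrite (_ : (_ * _)%:E = (\sum_(0 <= k < n) (t - x)%:E)%E); last first.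
    by rewrite sumEFin big_const_nat subn0 iter_addr_0 mulr_natl.
  rewrite big_nat [leRHS]big_nat; apply: lee_sum => k /andP[_ kn].
  rewrite (_ : U k `&` _ = `]x, t]%classic).
    by rewrite lebesgue_measure_itv /= lte_fin xt -EFinB.
  apply/seteqP; split => [y []//|y yxt]; split => //; apply: rU => //.
  move: yxt; rewrite /ball /= in_itv /= => /andP[xy yt].
  rewrite distrC gtr0_norm ?subr_gt0 //.
  rewrite (le_lt_trans (lerB yt (lexx x))) // ltrBlDl.
  by near: t; apply: nbhs_right_lt; rewrite ltrDl.
Unshelve. all: by end_near. Qed.

(** A continuation argument. The supremum s of the points where the bound holds is such a point: [F]
    is continuous, and for [G] monotonicity suffices since s is approached from the left. If s < d,
    the local inequality to the right of s produces a larger point. *)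
Lemma growth_le (F G : R -> R) (c d : R) : c <= d ->
  (forall x, c <= x <= d -> {for x, continuous F}) ->
  {homo G : x y / x <= y} ->
  (forall x, c <= x < d -> \forall t \near x^'+, F t - F x <= G t - G x) ->
  F d - F c <= G d - G c.
Proof.
move=> cd contF homoG FG.
pose S := [set t | c <= t <= d /\ F t - F c <= G t - G c].
have Sc : S c by rewrite /S /= lexx cd !subrr.
have supS : has_sup S by split; [exists c | exists d => t [/andP[]]].
pose s := sup S.
have cs : c <= s by apply: sup_upper_bound.
have sd : s <= d by apply: ge_sup; [exists c | move=> t [/andP[]]].
have Ss : S s.
  split; first by rewrite cs sd.
  apply/ler_addgt0Pl => e e0.
  have /cvgrPdist_lt/(_ e e0)/nbhs_ballP[r /= r0 rF] :=
    contF s (introT andP (conj cs sd)).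
  have [t St st] := sup_adherent r0 supS.
  have ts : t <= s by exact: sup_upper_bound.
  have /rF : ball s r t.
    by rewrite /ball /= ger0_norm ?subr_ge0 // ltrBlDr -ltrBlDl.
  move=> /ltW/(le_trans (ler_norm _)) Fst.
  rewrite -(subrKA (F t)) lerD //.
  case: St => _ /le_trans; apply; apply: lerB => //; exact: homoG.
move: sd; rewrite le_eqVlt => /predU1P[sd|sd]; first by rewrite -sd; case: Ss.
have [t [st [td Ft]]] : exists t, s < t /\ t <= d /\ F t - F s <= G t - G s.
  have := FG s (introT andP (conj cs sd)) => FGs.
  near s^'+ => t; exists t; split; last split.
  - by near: t; exact: nbhs_right_gt.
  - by near: t; exact: nbhs_right_ltW.
  - by near: t.
have St : S t.
  split; first by rewrite td (le_trans cs (ltW st)).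
  by rewrite -(subrKA (F s) (F t)) -(subrKA (G s) (G t)) lerD //; case: Ss.
by have := sup_upper_bound supS St; rewrite leNgt st.
Unshelve. all: by end_near. Qed.

Lemma near_slope_le (f : R -> R) (x e : R) : derivable f x 1 -> 0 < e ->
  \forall t \near x^'+,
    (derive1 f x - e) * (t - x) <= f t - f x <= (derive1 f x + e) * (t - x).
Proof.
move=> df e0.
have : h^-1 *: (f (h *: 1 + x) - f x) @[h --> 0^'] --> derive1 f x.
  by rewrite derive1E.
move=> /cvgrPdist_le/(_ e e0)/nbhs_ballP[r /= r0 rf].
near=> t.
have xt : 0 < t - x by rewrite subr_gt0; near: t; exact: nbhs_right_gt.
have := rf (t - x); rewrite /ball /= sub0r normrN gtr0_norm //.
rewrite ltrBlDl gt_eqF // => /(_ _ isT).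
have -> : t < x + r by near: t; apply: nbhs_right_lt; rewrite ltrDl.
move=> /(_ isT); rewrite [_ *: 1]mulr1 subrK.
rewrite ler_distlC -[_ *: _]/(_ * _) mulrC => /andP[h1 h2].
by rewrite -ler_pdivlMr // h1 -ler_pdivrMr.
Unshelve. all: by end_near. Qed.

(* The indefinite integral of k has derivative k off a null set Z; at the points
   of Z, where only its monotonicity is known, a steep function of small total
   growth makes up for it. *)
Lemma nonneg_growth_integral (F k : R -> R) (c d : R) : c <= d ->
  (forall x, c <= x <= d -> derivable F x 1) ->
  (forall x, 0 <= k x) -> mu.-integrable `[c, d] (EFin \o k) ->
  (forall x, c <= x <= d -> derive1 F x <= k x) ->
  F d - F c <= \int[mu]_(x in `[c, d]) k x.
Proof.
move=> cd dF k0 ik Fk.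
pose kc := k \_ `[c, d]%classic.
have kc0 x : 0 <= kc x by rewrite /kc patchE; case: ifP.
have ikc : mu.-integrable setT (EFin \o kc).
  by move: ik; rewrite integrable_mkcond // restrict_EFin.
have ikcS D : measurable D -> mu.-integrable D (EFin \o kc).
  by move=> mD; apply: integrableS ikc.
pose K x := \int[mu]_(t in `]-oo, x]) kc t.
have KB x y : x <= y -> K y - K x = \int[mu]_(t in `]x, y]) kc t.
  by move=> xy; rewrite /K Rintegral_itvB //; exact: ikcS.
have homoK : {homo K : x y / x <= y}.
  by move=> x y xy; rewrite -subr_ge0 KB // Rintegral_ge0.
have Kcd : K d - K c <= \int[mu]_(x in `[c, d]) k x.
  rewrite KB // Rintegral_itv_obnd_cbnd; last exact: ikcS.
  rewrite le_eqVlt; apply/orP; left; apply/eqP; apply: eq_Rintegral => x xcd.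
  by rewrite /kc patchE xcd.
have [Z [mZ Z0 KZ]] : {ae mu, forall x, derivable K x 1 /\ derive1 K x = kc x}.
  apply: FTC1Ny; first by move=> y; exact: ikcS.
  by apply: open_integrable_locally => //; exact: openT.
apply: (le_trans _ Kcd); apply/ler_addgt0Pl => e e0.
have [G [homoG G0e ZG]] : exists G : R -> R, [/\ {homo G : x y / x <= y},
    (forall x, 0 <= G x <= e / 2) & forall x (n : nat), Z x ->
    \forall t \near x^'+, n%:R * (t - x) <= G t - G x].
  by apply: null_set_steep; [exists Z; split | rewrite divr_gt0].
(* The linear term of [H] has slope 2 eta, one eta for the error of the difference quotient of [F]
   and one for that of [K]. Over [c, d] it grows by at most e / 2, and [G] by at most the other
   half; the + 1 covers the case c = d. *)
pose eta := e / 4 / (d - c + 1).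
have dc1 : 0 < d - c + 1 by rewrite ltr_wpDl ?subr_ge0.
have eta0 : 0 < eta by rewrite !divr_gt0.
pose H x := K x + G x + (eta + eta) * x.
have : F d - F c <= H d - H c.
  apply: growth_le => //.
  - move=> x xcd; apply: differentiable_continuous.
    by apply/derivable1_diffP; exact: dF.
  - move=> x y xy; rewrite /H !lerD ?homoK ?homoG //.
    by rewrite ler_wpM2l // addr_ge0 // ltW.
  - move=> x /andP[cx xd].
    have xcd : c <= x <= d by rewrite cx ltW.
    have Fx := near_slope_le (dF _ xcd) eta0.
    have [Zx|nZx] := pselect (Z x).
      (* On [Z] only monotonicity of [K] is available, so n is chosen above |F'(x)| and the
         steepness of [G] outgrows [F], up to one eta. *)
      have /archi_boundP := normr_ge0 (derive1 F x); set n := Num.bound _ => Fn.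
      have Gx := ZG x n Zx.
      near=> t.
      have xt : 0 <= t - x by rewrite subr_ge0; near: t; exact: nbhs_right_ge.
      have /andP[_ Ft] : (derive1 F x - eta) * (t - x) <= F t - F x <=
          (derive1 F x + eta) * (t - x).
        by near: t.
      have Gt : n%:R * (t - x) <= G t - G x by near: t.
      have Kt : K x <= K t by apply: homoK; rewrite -subr_ge0.
      have := ler_wpM2r xt (le_trans (ler_norm _) (ltW Fn)).
      have := mulr_ge0 (ltW eta0) xt.
      rewrite /H; nra.
    have [dK Kx] : derivable K x 1 /\ derive1 K x = kc x.
      by apply: contrapT => nK; apply: nZx; exact: KZ.
    have := near_slope_le dK eta0; rewrite Kx => KKx.
    near=> t.
    have xt : x <= t by near: t; exact: nbhs_right_ge.
    have Gt : G x <= G t by exact: homoG.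
    have /andP[_ Ft] : (derive1 F x - eta) * (t - x) <= F t - F x <=
          (derive1 F x + eta) * (t - x).
      by near: t; exact: Fx.
    have /andP[Kt _] : (kc x - eta) * (t - x) <= K t - K x <=
        (kc x + eta) * (t - x).
      by near: t; exact: KKx.
    have kx : kc x = k x by rewrite /kc patchE mem_set //= in_itv.
    have := Fk _ xcd; rewrite -kx => FK.
    have := ler_wpM2r (_ : 0 <= t - x) FK; rewrite subr_ge0 => /(_ xt).
    rewrite /H; nra.
move=> /le_trans; apply; rewrite /H.
have /andP[Gc _] := G0e c; have /andP[_ Gd] := G0e d.
have : (eta + eta) * (d - c) <= e / 2.
  have : eta * (d - c + 1) = e / 4 by rewrite /eta mulfVK // gt_eqF.
  by nra.
lra.
Unshelve. all: by end_near. Qed.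

Lemma normr_maxN_le (x y : R) : 0 <= x -> `|Num.max y (- x)| <= `|y|.
Proof.
move=> x0; have [yx|//] := leP y (- x).
have y0 : y <= 0 by rewrite (le_trans yx) // oppr_le0.
by rewrite normrN ger0_norm // ler0_norm // lerNr.
Qed.

(* Truncating the derivative at -n and adding n to it reduces to the previous
   lemma; then n goes to infinity. *)
Lemma growth_le_integral (F : R -> R) (c d : R) : c <= d ->
  (forall x, c <= x <= d -> derivable F x 1) ->
  mu.-integrable `[c, d] (EFin \o derive1 F) ->
  F d - F c <= \int[mu]_(x in `[c, d]) derive1 F x.
Proof.
move=> cd dF iF.
have mF : measurable_fun `[c, d]%classic (derive1 F).
  by apply/measurable_EFinP; exact: measurable_int iF.
pose h (n : nat) (x : R) : R := Num.max (derive1 F x) (- n%:R).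
have mh n : measurable_fun `[c, d]%classic (h n).
  by apply: measurable_maxr => //; exact: measurable_cst.
have h_le n x : `|h n x| <= `|derive1 F x|.
  exact: normr_maxN_le (ler0n _ _).
have ih n : mu.-integrable `[c, d] (EFin \o h n).
  apply: le_integrable iF => //; first by apply/measurable_EFinP; exact: mh.
  by move=> x _; rewrite /= lee_fin.
have Fmax n : F d - F c <= \int[mu]_(x in `[c, d]) h n x.
  (* Adding n x makes the majorant max(F', -n) + n nonnegative, as [nonneg_growth_integral]
     requires; the contribution n (d - c) then drops out on both sides. *)
  pose Fn x := F x + n%:R * x.
  have dFn x : c <= x <= d -> is_derive x 1 Fn (derive1 F x + n%:R).
    move=> /dF/derivableP dFx; rewrite derive1E.
    have := is_deriveD dFx (@is_deriveM R R (cst n%:R) id x 1 0 1 _ _).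
    by rewrite scaler0 addr0 [_ *: 1]mulr1; apply.
  have k_ge0 x : 0 <= h n x + n%:R by rewrite -[n%:R]opprK subr_ge0 le_max
    lexx orbT.
  have ic : mu.-integrable `[c, d] (EFin \o cst (n%:R : R)).
    apply: continuous_compact_integrable; first exact: segment_compact.
    by apply: continuous_subspaceT => ?; exact: cvg_cst.
  have : Fn d - Fn c <= \int[mu]_(x in `[c, d]) (h n x + n%:R).
    apply: nonneg_growth_integral => //.
    - by move=> x xcd; exact: (@ex_derive _ _ _ _ _ _ _ (dFn x xcd)).
    - exact: (integrableD _ (ih n) ic).
    - move=> x xcd; rewrite derive1E (@derive_val _ _ _ _ _ _ _ (dFn x xcd)).
      by rewrite lerD2r le_max lexx.
  rewrite RintegralD // Rintegral_cst //= lebesgue_measure_itv /= lte_fin.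
  have -> : fine (if (c < d)%R then d%:E - c%:E else 0)%E = d - c.
    case: ifPn => //; rewrite -leNgt => dc.
    by rewrite (_ : c = d) ?subrr //; apply/eqP; rewrite eq_le cd.
  by rewrite /Fn; lra.
have Fcvg : \int[mu]_(x in `[c, d]) h n x @[n --> \oo]
    --> \int[mu]_(x in `[c, d]) derive1 F x.
  apply: fine_cvg; rewrite fineK ?integrable_fin_num //.
  have [|||||_ _ //] := @dominated_convergence _ _ R mu `[c,
    d]%classic (measurable_itv _)
    (fun n x => (h n x)%:E) (EFin \o derive1 F) (fun x => `|derive1 F x|%:E).
  - by move=> n; apply/measurable_EFinP; exact: mh.
  - exact/measurable_EFinP.
  - apply: aeW => x _; apply: cvg_EFin; first exact: nearW.
    apply: cvg_near_cst; near=> n.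
    rewrite /h /= max_l // lerNl (le_trans (ler_norm _)) // normrN.
    by near: n; exact: nbhs_infty_ger.
  - exact: integrable_norm.
  - by apply: aeW => x n _; rewrite /= lee_fin.
rewrite -(cvg_lim _ Fcvg) //.
apply: limr_ge; first by apply/cvg_ex; eexists; exact: Fcvg.
by apply: nearW.
Unshelve. all: by end_near. Qed.

(** The one-sided estimate, applied to F and to -F. *)
Lemma FTC2_derivable (F : R -> R) (c d : R) : c <= d ->
  (forall x, c <= x <= d -> derivable F x 1) ->
  mu.-integrable `[c, d] (EFin \o derive1 F) ->
  \int[mu]_(x in `[c, d]) derive1 F x = F d - F c.
Proof.
move=> cd dF iF; apply/eqP; rewrite eq_le growth_le_integral // andbT.
have dNF x : c <= x <= d -> is_derive x 1 (\- F) (- derive1 F x).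
  move=> /dF/derivableP dFx; rewrite derive1E; exact: is_deriveN.
have NF x : x \in `[c, d]%classic -> derive1 (\- F) x = - derive1 F x.
  rewrite inE /= in_itv /= => xcd.
  by rewrite derive1E; have /@derive_val := dNF _ xcd.
have iN : mu.-integrable `[c, d] (EFin \o (fun x => - derive1 F x)).
  exact: integrableN iF.
have iNF : mu.-integrable `[c, d] (EFin \o derive1 (\- F)).
  by apply: eq_integrable iN => // x xcd; rewrite /= NF.
have H := @growth_le_integral (\- F) c d cd
  (fun x xcd => @ex_derive _ _ _ _ _ _ _ (dNF x xcd)) iNF.
rewrite -lerN2 -[leRHS]mulN1r -RintegralZl //.
apply: le_trans (le_trans H _); first by rewrite opprB /= opprK addrC.
rewrite (@eq_Rintegral _ _ _ mu _ (fun x => -1 * derive1 F x)) // => x xcd.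
by rewrite NF // mulN1r.
Qed.

End FTC_derivable.

(** * Complex-valued integrals *)

Section ComplexParts.
Local Open Scope complex_scope.
Context {R : realType}.
Implicit Types (x y z : R[i]) (r s : R).

Lemma Re_addc x y : complex.Re (x + y) = complex.Re x + complex.Re y.
Proof. by case: x; case: y. Qed.

Lemma Im_addc x y : complex.Im (x + y) = complex.Im x + complex.Im y.
Proof. by case: x; case: y. Qed.

Lemma Re_mulc x y : complex.Re (x * y) =
  complex.Re x * complex.Re y - complex.Im x * complex.Im y.
Proof. by case: x; case: y. Qed.

Lemma Im_mulc x y : complex.Im (x * y) =
  complex.Re x * complex.Im y + complex.Im x * complex.Re y.
Proof. by case: x; case: y. Qed.

Lemma normc_Re_le z r : `|z| <= r%:C -> `|complex.Re z| <= r.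
Proof.
rewrite normc_def lecR; apply: le_trans; rewrite -sqrtr_sqr.
by rewrite ler_wsqrtr // lerDl sqr_ge0.
Qed.

Lemma normc_Im_le z r : `|z| <= r%:C -> `|complex.Im z| <= r.
Proof.
rewrite normc_def lecR; apply: le_trans; rewrite -sqrtr_sqr.
by rewrite ler_wsqrtr // lerDr sqr_ge0.
Qed.

Lemma normc_le_ReIm z r s : `|complex.Re z| <= r -> `|complex.Im z| <= s ->
  `|z| <= (r + s)%:C.
Proof.
move=> zr zs; have r0 := le_trans (normr_ge0 _) zr.
have s0 := le_trans (normr_ge0 _) zs.
rewrite normc_def lecR -[leRHS]ger0_norm ?addr_ge0 // -sqrtr_sqr ler_wsqrtr //.
rewrite -[in leLHS](real_normK (num_real (complex.Re z))).
rewrite -[in leLHS](real_normK (num_real (complex.Im z))).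
rewrite sqrrD (le_trans (lerD _ _ : _ <= r ^+ 2 + s ^+ 2)) ?lerXn2r ?nnegrE //.
by rewrite -addrA [X in _ <= _ + X]addrC addrA lerDl mulrn_wge0 // mulr_ge0.
Qed.

Lemma gt0_real_complex x : 0 < x -> exists2 r, 0 < r & x = r%:C.
Proof.
case: x => r s; rewrite ltcE /= => /andP[/eqP -> r0]; by exists r.
Qed.
End ComplexParts.

Section ComplexIntegral.
Local Open Scope complex_scope.
Context {R : realType}.
Notation mu := (@lebesgue_measure R).
Variable D : set R.
Hypothesis mD : measurable D.
Implicit Types (f g : R -> R[i]) (c : R[i]).

Lemma cintegrable0 : cintegrable D (fun=> 0).
Proof. by split; exact: integrable0. Qed.

Lemma cintegral0 : cintegral D (fun=> 0 : R[i]) = 0.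
Proof. by rewrite /cintegral /= !Rintegral_cst // !mul0r. Qed.

Lemma eq_cintegral g f : (forall t, D t -> f t = g t) ->
  cintegral D f = cintegral D g.
Proof.
by move=> fg; congr (_ +i* _); apply: eq_Rintegral => t /set_mem/fg ->.
Qed.

Lemma cintegrableD f g : cintegrable D f -> cintegrable D g ->
  cintegrable D (fun t => f t + g t).
Proof.
by move=> [f1 f2] [g1 g2]; split;
  under eq_fun do rewrite ?Re_addc ?Im_addc EFinD;
  exact: integrableD.
Qed.

Lemma cintegralD f g : cintegrable D f -> cintegrable D g ->
  cintegral D (fun t => f t + g t) = cintegral D f + cintegral D g.
Proof.
move=> [f1 f2] [g1 g2]; rewrite /cintegral.
under eq_Rintegral do rewrite Re_addc.
under [in X in _ +i* X]eq_Rintegral do rewrite Im_addc.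
by rewrite !RintegralD.
Qed.

Let integrable_scale (u : R -> R) r : mu.-integrable D (EFin \o u) ->
  mu.-integrable D (EFin \o (fun t => r * u t)).
Proof. exact: integrableZl. Qed.

Let integrable_comb (p q : R -> R) (r s : R) :
  mu.-integrable D (EFin \o p) -> mu.-integrable D (EFin \o q) ->
  mu.-integrable D (EFin \o (fun t => r * p t + s * q t)).
Proof.
move=> ip iq; rewrite (_ : _ \o _ = (fun t => r%:E * (p t)%:E) \+
  (fun t => s%:E * (q t)%:E))%E //.
by apply: integrableD => //; exact: integrableZl.
Qed.

Let Rintegral_comb (p q : R -> R) (r s : R) :
  mu.-integrable D (EFin \o p) -> mu.-integrable D (EFin \o q) ->
  \int[mu]_(t in D) (r * p t + s * q t) =
  r * \int[mu]_(t in D) p t + s * \int[mu]_(t in D) q t.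
Proof.
move=> ip iq.
by rewrite RintegralD ?RintegralZl //; exact: integrable_scale.
Qed.

Lemma cintegrableZ c f : cintegrable D f -> cintegrable D (fun t => c * f t).
Proof.
move=> [f1 f2]; split; under eq_fun do rewrite ?Re_mulc ?Im_mulc.
  by under eq_fun do rewrite -mulNr; exact: integrable_comb.
exact: integrable_comb.
Qed.

Lemma cintegralZ c f : cintegrable D f ->
  cintegral D (fun t => c * f t) = c * cintegral D f.
Proof.
move=> [f1 f2]; rewrite /cintegral.
under eq_Rintegral do rewrite Re_mulc -mulNr.
under [in X in _ +i* X]eq_Rintegral do rewrite Im_mulc.
rewrite !Rintegral_comb //; case: c => r s /=; apply/eqP.
by rewrite eq_complex /= mulNr !eqxx.
Qed.

Lemma conj_cintegral f : cintegrable D f ->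
  ((cintegral D f)^*)%R = cintegral D (fun t => ((f t)^*)%R).
Proof.
move=> [f1 f2]; rewrite /cintegral.
rewrite [LHS]/=; apply/eqP; rewrite eq_complex /=; apply/andP; split; apply/eqP.
  by apply: eq_Rintegral => t _; case: (f t).
rewrite -mulN1r -RintegralZl //; apply: eq_Rintegral => t _.
by case: (f t) => r s /=; rewrite mulN1r.
Qed.

(** The factors that may be put in front of an integrable function. The class is closed under
    products; it is used for 1, for the resolvent 1/(t - z) and for its square. *)
Definition bounded_multiplier f := exists C : R,
  [/\ measurable_fun D (fun t => complex.Re (f t)),
      measurable_fun D (fun t => complex.Im (f t)) &
      forall t, D t -> `|f t| <= C%:C].

Lemma bounded_multiplierM f g : bounded_multiplier f -> bounded_multiplier g ->
  bounded_multiplier (fun t => f t * g t).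
Proof.
move=> [C [f1 f2 fC]] [C' [g1 g2 gC]]; exists (C * C'); split.
- under eq_fun do rewrite Re_mulc.
  by apply: measurable_funB; exact: measurable_funM.
- under eq_fun do rewrite Im_mulc.
  by apply: measurable_funD; exact: measurable_funM.
- move=> t Dt; rewrite normrM rmorphM.
  by apply: ler_pM => //; [exact: fC | exact: gC].
Qed.

Lemma bounded_multiplier_integrable f (v : R -> R) : bounded_multiplier f ->
  mu.-integrable D (EFin \o v) -> cintegrable D (fun t => f t * (v t)%:C).
Proof.
move=> [C [f1 f2 fC]] iv.
have bound (h : R -> R) : measurable_fun D h -> (forall t, D t ->
  `|h t| <= C) ->
    mu.-integrable D (EFin \o (fun t => h t * v t)).
  move=> mh hC; have := @integrableMr _ _ R mu D mD h (EFin \o v) mh.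
  apply=> //.
  exists C; split; first by rewrite num_real.
  by move=> M CM t Dt; apply: (le_trans (hC _ Dt)); exact: ltW.
split.
  under eq_fun do rewrite Re_mulc /= mulr0 subr0.
  by apply: bound => // t /fC/normc_Re_le.
under eq_fun do rewrite Im_mulc /= mulr0 add0r.
by apply: bound => // t /fC/normc_Im_le.
Qed.

(** Real and imaginary parts are estimated separately, whence the harmless factor 2. *)
Lemma norm_cintegral_le f (v : R -> R) (C : R) :
  measurable_fun D (fun t => complex.Re (f t)) ->
  measurable_fun D (fun t => complex.Im (f t)) ->
  (forall t, D t -> `|f t| <= C%:C) -> mu.-integrable D (EFin \o v) ->
  `|cintegral D (fun t => f t * (v t)%:C)| <=
    (C * \int[mu]_(t in D) `|v t| + C * \int[mu]_(t in D) `|v t|)%:C.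
Proof.
move=> f1 f2 fC iv.
have [i1 i2] : cintegrable D (fun t => f t * (v t)%:C).
  by apply: bounded_multiplier_integrable => //; exists C.
have inv : mu.-integrable D (EFin \o (fun t => C * `|v t|)).
  by apply: (@integrable_scale (fun t => `|v t|)); exact: integrable_norm.
rewrite -RintegralZl //; last exact: integrable_norm.
apply: normc_le_ReIm; apply: (le_trans (le_normr_Rintegral _ _)) => //;
  apply: le_Rintegral => //; try exact: integrable_norm.
  move=> t Dt; rewrite Re_mulc /= mulr0 subr0 normrM ler_wpM2r //.
  by apply: normc_Re_le; exact: fC.
move=> t Dt; rewrite Im_mulc /= mulr0 add0r normrM ler_wpM2r //.
by apply: normc_Im_le; exact: fC.
Qed.
End ComplexIntegral.

Section SlitPlane.
Local Open Scope complex_scope.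
Context {R : realType}.
Notation mu := (@lebesgue_measure R).
Variables a b : \bar R.
Hypothesis ab : (a < b)%E.

Lemma open_ointerval : open (ointerval a b).
Proof.
rewrite (_ : ointerval a b =
    [set x | (a < x%:E)%E] `&` [set x | (x%:E < b)%E]) //.
apply: openI.
  case: a => [r||]; first by under eq_set do rewrite lte_fin; exact: open_gt.
    rewrite (_ : [set _ | _] = set0); first exact: open0.
    by apply/seteqP; split.
  rewrite (_ : [set _ | _] = setT); first exact: openT.
  by apply/seteqP; split => // x _; exact: ltNyr.
case: b => [r||]; first by under eq_set do rewrite lte_fin; exact: open_lt.
  rewrite (_ : [set _ | _] = setT); first exact: openT.
  by apply/seteqP; split => // x _; exact: ltry.
rewrite (_ : [set _ | _] = set0); first exact: open0.
by apply/seteqP; split.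
Qed.

Lemma measurable_ointerval : measurable (ointerval a b).
Proof. exact: open_measurable open_ointerval. Qed.

(** For nonreal z the distance |Im z| works. A real z lies strictly on one side of [a, b], and its
    distance to the end point there, which is then finite, works. *)
Lemma slit_plane_dist z : slit_plane a b z ->
  exists2 d : R, 0 < d & forall t, ointerval a b t -> d%:C <= `|t%:C - z|.
Proof.
case: z => x y; rewrite /slit_plane /= => zab.
have distE t : `|t%:C - (x +i* y)| =
    (Num.sqrt ((t - x) ^+ 2 + (0 - y) ^+ 2))%:C by rewrite normc_def.
have [y0|y0] := eqVneq y 0; last first.
  exists `|y|; first by rewrite normr_gt0.
  move=> t _; rewrite distE lecR -sqrtr_sqr ler_wsqrtr //.
  by rewrite sub0r sqrrN lerDr sqr_ge0.
have re_dist t : `|t%:C - (x +i* y)| = `|t - x|%:C.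
  by rewrite distE y0 subrr expr0n addr0 sqrtr_sqr.
have : ~ cinterval a b x by move=> xab; exact: zab.
rewrite /cinterval /= => /not_andP[/negP|/negP]; rewrite -ltNge.
  case: a ab => [r _|+ _|_ ]; rewrite ?ltNge ?leNye ?leey //= -ltNge.
  rewrite lte_fin => xr; exists (r - x); first by rewrite subr_gt0.
  move=> t [/= rt _]; rewrite re_dist lecR (le_trans _ (ler_norm _)) //.
  by rewrite lerD2r ltW.
case: b ab => [r _|_|+ _]; rewrite ?ltNge ?leNye ?leey //= -ltNge.
rewrite lte_fin => xr; exists (x - r); first by rewrite subr_gt0.
move=> t [_ /= rt]; rewrite re_dist lecR distrC (le_trans _ (ler_norm _)) //.
by rewrite lerD2l lerN2 ltW.
Qed.

Lemma slit_plane_conj z : slit_plane a b z -> slit_plane a b ((z^*)%R).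
Proof.
case: z => x y; rewrite /slit_plane /= => zab [/eqP y0 xab].
by apply: zab; split => //; apply/eqP; rewrite -oppr_eq0.
Qed.

End SlitPlane.

(** * Differentiation of Cauchy integrals under the integral sign *)

Section Resolvent.
Local Open Scope complex_scope.
Context {R : realType}.
Notation mu := (@lebesgue_measure R).
Variable D : set R.
Hypothesis oD : open D.
Let mD : measurable D. Proof. exact: open_measurable. Qed.

Lemma norm_inv_le (w : R[i]) (d : R) : 0 < d -> d%:C <= `|w| ->
  `|w^-1| <= (d^-1)%:C.
Proof.
move=> d0 dw; rewrite normfV rmorphV ?unitfE ?gt_eqF //.
have d0C : 0 < d%:C by rewrite ltcR.
by rewrite lef_pV2 // posrE // (lt_le_trans d0C).
Qed.

Lemma bounded_multiplier_resolvent (z : R[i]) (d : R) : 0 < d ->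
  (forall t, D t -> d%:C <= `|t%:C - z|) ->
  bounded_multiplier D (fun t => (t%:C - z)^-1).
Proof.
move=> d0 dz; exists d^-1; split; last by move=> t /dz; exact: norm_inv_le.
(* [n] is |t - z|^2, the common denominator of both parts of 1/(t - z); measurability of the two
   parts follows from continuity on the open set [D]. *)
all: case: z dz => x y dz; pose n (t : R) := (t - x) ^+ 2 + (0 - y) ^+ 2.
all: have n0 t : D t -> n t != 0.
1,3: move=> /dz; rewrite normc_def lecR => dn; apply/eqP => nt0.
1,2: by move: dn; rewrite -/(n t) nt0 sqrtr0 leNgt d0.
all: have contn t : D t -> {for t, continuous (fun t => (n t)^-1)}.
1,3: move=> Dt; apply: continuousV; first exact: n0.
1,2: apply: cvgD; last exact: cvg_cst.
1,2: by apply: cvgM; apply: cvgB => //; exact: cvg_cst.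
- apply: open_continuous_measurable_fun => // t; rewrite inE => Dt.
  apply: cvgM; last exact: contn.
  by apply: cvgB => //; exact: cvg_cst.
- apply: open_continuous_measurable_fun => // t; rewrite inE => Dt.
  apply: cvgN; apply: cvgM; last exact: contn.
  exact: cvg_cst.
Qed.

(** By the resolvent identity, the candidate derivative minus the difference quotient is -h times
    the integral of v / ((t - z - h) (t - z)^2). For |h| < d / 2 all denominators stay away from 0,
    so this error is O(|h|). *)
Lemma is_derive_cauchy_integral (v : R -> R) (z : R[i]) (d : R) :
  mu.-integrable D (EFin \o v) -> 0 < d ->
  (forall t, D t -> d%:C <= `|t%:C - z|) ->
  is_derive (z : R[i]^o) 1
    (fun w : R[i]^o => cintegral D (fun t => (t%:C - w)^-1 * (v t)%:C) : R[i]^o)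
    (cintegral D (fun t => ((t%:C - z)^-1 * (t%:C - z)^-1) * (v t)%:C)).
Proof.
move=> iv d0 dz; set F := fun w => _; set l := cintegral _ _.
have d20 : 0 < d / 2 by rewrite divr_gt0.
pose I := \int[mu]_(t in D) `|v t|.
have I0 : 0 <= I by apply: Rintegral_ge0.
pose K := (d / 2)^-1 * (d^-1 * d^-1).
have K0 : 0 <= K by rewrite !mulr_ge0 ?invr_ge0 // ltW.
have bz := bounded_multiplier_resolvent d0 dz.
have near_z h : `|h| < (d / 2)%:C -> h != 0 ->
    `|l - h^-1 * (F (h + z) - F z)| <= `|h| * (K * I + K * I)%:C.
  move=> hd h0.
  have dh t : D t -> (d / 2)%:C <= `|t%:C - (h + z)|.
    move=> Dt; have := lerB (dz _ Dt) (ltW hd); rewrite -rmorphB.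
    rewrite (_ : d - d / 2 = d / 2); last by field.
    move=> /le_trans; apply; rewrite [h + z]addrC opprD addrA.
    exact: lerB_dist.
  have bh := bounded_multiplier_resolvent d20 dh.
  have bb := bounded_multiplierM bh (bounded_multiplierM bz bz).
  have ih := bounded_multiplier_integrable mD bh iv.
  have iz := bounded_multiplier_integrable mD bz iv.
  have izz := bounded_multiplier_integrable mD (bounded_multiplierM bz bz) iv.
  have ib := bounded_multiplier_integrable mD bb iv.
  have -> : l - h^-1 * (F (h + z) - F z) = - h *
      cintegral D (fun t => (t%:C - (h + z))^-1 *
        ((t%:C - z)^-1 * (t%:C - z)^-1) * (v t)%:C).
    rewrite {1}/l (@eq_cintegral _ _ (fun t => - h * ((t%:C - (h + z))^-1 *
      ((t%:C - z)^-1 * (t%:C - z)^-1) * (v t)%:C) +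
      (h^-1 * ((t%:C - (h + z))^-1 * (v t)%:C) +
       - h^-1 * ((t%:C - z)^-1 * (v t)%:C)))); last first.
      move=> t Dt; have tz : t%:C - z != 0.
        by rewrite -normr_gt0 (lt_le_trans _ (dz _ Dt)) // ltcR.
      have thz : t%:C - (h + z) != 0.
        by rewrite -normr_gt0 (lt_le_trans _ (dh _ Dt)) // ltcR.
      by field; rewrite h0 tz.
    rewrite !cintegralD ?cintegralZ //; try exact: cintegrableZ;
      last by apply: cintegrableD => //; exact: cintegrableZ.
    by rewrite /F; ring.
  rewrite normrM normrN ler_wpM2l //; case: (bb) => _ [m1 m2 _].
  apply: norm_cintegral_le => // t Dt.
  rewrite !normrM !rmorphM /=.
  by rewrite !ler_pM ?mulr_ge0 ?norm_inv_le ?dh ?dz.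
have Fl : (fun h : R[i]^o => h^-1 *: (F (h *: (1 : R[i]^o) + z) - F z) : R[i]^o)
    @ (0 : R[i]^o)^' --> (l : R[i]^o).
  apply/cvgrPdist_le => e /gt0_real_complex[r r0 ->].
  (* The + 1 keeps [M] positive, so that r / [M] makes sense even if the integral of |v| is 0. *)
  pose M := K * I + K * I + 1.
  have M0 : 0 < M by rewrite ltr_wpDl // addr_ge0 // mulr_ge0.
  near=> h.
  rewrite [h *: 1]mulr1; apply: (le_trans (near_z _ _ _)).
  - by near: h; apply: dnbhs0_lt; rewrite ltcR.
  - by near: h; exact: nbhs_dnbhs_neq.
  - apply: (@le_trans _ _ (`|h| * M%:C)).
      by rewrite ler_wpM2l // lecR lerDl.
    rewrite -ler_pdivlMr ?ltcR // -fmorphV -rmorphM.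
    by near: h; apply: dnbhs0_le; rewrite ltcR divr_gt0.
by split; [apply/cvg_ex; exists l | apply/cvg_lim].
Unshelve. all: by end_near. Qed.

Lemma cvg_complex_parts (T : Type) (F : set_system T) {FF : Filter F}
    (f : T -> R[i]) (l : R[i]) :
  (f t : R[i]^o) @[t --> F] --> (l : R[i]^o) ->
  complex.Re (f t) @[t --> F] --> complex.Re l /\
  complex.Im (f t) @[t --> F] --> complex.Im l.
Proof.
move=> /cvgrPdist_le fl; split; apply/cvgrPdist_le => e e0.
  have := fl e%:C; rewrite ltcR => /(_ e0); apply: filterS => t /normc_Re_le.
  by rewrite Re_addc; case: (f t).
have := fl e%:C; rewrite ltcR => /(_ e0); apply: filterS => t /normc_Im_le.
by rewrite Im_addc; case: (f t).
Qed.

End Resolvent.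

(** * The fundamental theorem on the open, possibly infinite, interval *)

Section ImproperFTC.
Local Open Scope complex_scope.
Context {R : realType}.
Notation mu := (@lebesgue_measure R).

(** Sequences make dominated convergence applicable to the filters at the end points. The interior
    point m separates the lower sequence from the upper one, so that [c n, d n] is never
    reversed. *)
Lemma at_lower_sequence (a : \bar R) (m : R) : (a < m%:E)%E ->
  exists c : R^nat, (forall n, (a < (c n)%:E)%E /\ c n <= m) /\
    c n @[n --> \oo] --> at_lower a.
Proof.
case: a => [r||].
- rewrite lte_fin => rm; exists (fun n => r + (m - r) / n.+1%:R); split => [n|].
    rewrite lte_fin ltrDl divr_gt0 ?subr_gt0 //; split => //.
    rewrite -lerBrDl ler_pdivrMr // ler_peMr ?subr_ge0 ?(ltW rm) //.
    by rewrite ler1n.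
  move=> P [e /= e0 eP].
  change (\forall n \near \oo, P (r + (m - r) / n.+1%:R)); near=> n; apply: eP.
    rewrite /ball_ /= opprD addrA subrr sub0r normrN gtr0_norm; last first.
      by rewrite divr_gt0 // subr_gt0.
    rewrite ltr_pdivrMr // mulrC -ltr_pdivrMr //.
    rewrite (@le_lt_trans _ _ n%:R) ?ltr_nat //.
    by near: n; exact: nbhs_infty_ger.
  by rewrite ltrDl divr_gt0 // subr_gt0.
- by rewrite ltNge leey.
- move=> _; exists (fun n => m - n%:R); split => [n|].
    by rewrite ltNyr lerBlDr lerDl.
  move=> P [M [_ MP]].
  change (\forall n \near \oo, P (m - n%:R)); near=> n; apply: MP.
  rewrite ltrBlDr -ltrBlDl (@lt_le_trans _ _ n%:R) //.
  by near: n; exact: nbhs_infty_gtr.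
Unshelve. all: by end_near. Qed.

Lemma at_upper_sequence (b : \bar R) (m : R) : (m%:E < b)%E ->
  exists d : R^nat, (forall n, ((d n)%:E < b)%E /\ m <= d n) /\
    d n @[n --> \oo] --> at_upper b.
Proof.
case: b => [r||].
- rewrite lte_fin => mr; exists (fun n => r - (r - m) / n.+1%:R); split => [n|].
    rewrite lte_fin ltrBlDr ltrDl divr_gt0 ?subr_gt0 //; split => //.
    rewrite lerBrDr -lerBrDl ler_pdivrMr // ler_peMr ?subr_ge0 ?(ltW mr) //.
    by rewrite ler1n.
  move=> P [e /= e0 eP].
  change (\forall n \near \oo, P (r - (r - m) / n.+1%:R)); near=> n; apply: eP.
    rewrite /ball_ /= opprB addrCA subrr addr0 gtr0_norm; last first.
      by rewrite divr_gt0 // subr_gt0.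
    rewrite ltr_pdivrMr // mulrC -ltr_pdivrMr //.
    rewrite (@le_lt_trans _ _ n%:R) ?ltr_nat //.
    by near: n; exact: nbhs_infty_ger.
  by rewrite ltrBlDr ltrDl divr_gt0 // subr_gt0.
- move=> _; exists (fun n => m + n%:R); split => [n|].
    by rewrite ltry lerDl.
  move=> P [M [_ MP]].
  change (\forall n \near \oo, P (m + n%:R)); near=> n; apply: MP.
  rewrite -ltrBlDl (@lt_le_trans _ _ n%:R) //.
  by near: n; exact: nbhs_infty_gtr.
- by rewrite ltNge leNye.
Unshelve. all: by end_near. Qed.

Variables a b : \bar R.
Hypothesis ab : (a < b)%E.
Notation D := (ointerval a b).

Lemma ointerval_nonempty : exists m, D m.
Proof.
case: a b ab => [r||] [s||] //; rewrite ?lte_fin => rs.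
- by exists ((r + s) / 2); split; rewrite lte_fin !midf_lt.
- by exists (r + 1); split; rewrite ?ltry // lte_fin ltrDl.
- by exists (s - 1); split; rewrite ?ltNyr // lte_fin ltrBlDr ltrDl.
- by exists 0; split; rewrite ?ltNyr ?ltry.
Qed.

Lemma at_lower_le t : (a < t%:E)%E -> at_lower a [set s | s <= t].
Proof.
case: a => [r||]; rewrite ?lte_fin ?ltNge ?leey //.
  by rewrite -ltNge; exact: nbhs_right_ltW.
by move=> _; exists t; split; [exact: num_real | move=> x /ltW].
Qed.

Lemma at_upper_ge t : (t%:E < b)%E -> at_upper b [set s | t <= s].
Proof.
case: b => [r||]; rewrite ?lte_fin ?ltNge ?leNye //.
  by rewrite -ltNge; exact: nbhs_left_ge.
by move=> _; exists t; split; [exact: num_real | move=> x /ltW].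
Qed.

(** The compact version holds on [c n, d n]. As n grows, these intervals eventually contain each
    point of the open interval, so the integrals converge by domination by |f|, while the boundary
    values converge by assumption. *)
Lemma FTC2_ointerval (F f : R -> R) (la lb : R) :
  (forall t, D t -> is_derive t 1 F (f t)) ->
  mu.-integrable D (EFin \o f) ->
  F t @[t --> at_lower a] --> la -> F t @[t --> at_upper b] --> lb ->
  \int[mu]_(t in D) f t = lb - la.
Proof.
move=> dF intf Fa Fb; have mD := measurable_ointerval a b.
have [m [am mb]] := ointerval_nonempty.
have [c [cam ca]] := at_lower_sequence am.
have [d [dmb db]] := at_upper_sequence mb.
have cdD n t : t \in `[c n, d n] -> D t.
  rewrite in_itv /= => /andP[ct td]; split.
    by apply: (lt_le_trans (cam n).1); rewrite lee_fin.
  by apply: (le_lt_trans _ (dmb n).1); rewrite lee_fin.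
have cd n : c n <= d n by apply: (le_trans (cam n).2); case: (dmb n).
have FTC n : \int[mu]_(t in `[c n, d n]) f t = F (d n) - F (c n).
  have dFn t : c n <= t <= d n -> is_derive t 1 F (f t).
    by move=> ctd; apply/dF/(cdD n); rewrite in_itv.
  have fE t : t \in `[c n, d n]%classic -> f t = derive1 F t.
    rewrite inE /= in_itv /= => ctd; rewrite derive1E.
    by rewrite (@derive_val _ _ _ _ _ _ _ (dFn t ctd)).
  rewrite (@eq_Rintegral _ _ _ mu _ (derive1 F) f fE).
  apply: FTC2_derivable => //.
    by move=> t ctd; exact: (@ex_derive _ _ _ _ _ _ _ (dFn t ctd)).
  have ifn : mu.-integrable `[c n, d n] (EFin \o f).
    by apply: integrableS intf => // t /cdD.
  by apply: eq_integrable ifn => // t tcd; rewrite /= -fE.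
have lim1 : \int[mu]_(t in `[c n, d n]) f t @[n --> \oo] --> lb - la.
  under eq_fun do rewrite FTC.
  by apply: cvgB; [exact: cvg_comp db Fb | exact: cvg_comp ca Fa].
have lim2 : \int[mu]_(t in `[c n, d n]) f t @[n --> \oo]
    --> \int[mu]_(t in D) f t.
  have restrictE n : \int[mu]_(t in `[c n, d n]) f t =
      \int[mu]_(t in D) (f \_ `[c n, d n]) t.
    rewrite -Rintegral_mkcondr; congr Rintegral.
    by apply/seteqP; split => [t tcd|t [] //]; split => //; exact: (cdD n).
  under eq_fun do rewrite restrictE.
  apply: fine_cvg; rewrite fineK ?integrable_fin_num //.
  have mf : measurable_fun D f by apply/measurable_EFinP;
    exact: measurable_int intf.
  have [|||||_ _ //] := @dominated_convergence _ _ R mu D mD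
    (fun n t => ((f \_ `[c n, d n]) t)%:E) (EFin \o f) (fun t => `|f t|%:E).
  - move=> n; apply/measurable_EFinP.
    apply/(measurable_restrict f (measurable_itv `[c n, d n]) mD).
    by apply: (measurable_funS mD _ mf) => t [].
  - exact/measurable_EFinP.
  - apply: aeW => t [ta tb]; apply: cvg_EFin; first exact: nearW.
    apply: cvg_near_cst.
    have nc : \forall n \near \oo, c n <= t := ca _ (at_lower_le ta).
    have nd : \forall n \near \oo, t <= d n := db _ (at_upper_ge tb).
    near=> n; rewrite /= patchE mem_set //= in_itv /=.
    by apply/andP; split; near: n.
  - exact: integrable_norm.
  - apply: aeW => t n _; rewrite /= lee_fin patchE.
    by case: ifPn => //; rewrite normr0.
exact: (cvg_unique _ lim2 lim1).
Unshelve. all: by end_near. Qed.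

Lemma cFTC2_ointerval (F f : R -> R[i]) (la lb : R[i]) :
  (forall t, D t ->
    is_derive t 1 (fun s => complex.Re (F s)) (complex.Re (f t)) /\
    is_derive t 1 (fun s => complex.Im (F s)) (complex.Im (f t))) ->
  cintegrable D f ->
  (F t : R[i]^o) @[t --> at_lower a] --> (la : R[i]^o) ->
  (F t : R[i]^o) @[t --> at_upper b] --> (lb : R[i]^o) ->
  cintegral D f = lb - la.
Proof.
move=> dF [f1 f2].
have Fa : Filter (at_lower a).
  by rewrite /at_lower; case: a => [r||]; typeclasses eauto.
have Fb : Filter (at_upper b).
  by rewrite /at_upper; case: b => [r||]; typeclasses eauto.
move=> /(cvg_complex_parts)[ra ia] /cvg_complex_parts[rb ib].
rewrite /cintegral (FTC2_ointerval (fun t Dt => (dF t Dt).1) f1 ra rb).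
rewrite (FTC2_ointerval (fun t Dt => (dF t Dt).2) f2 ia ib).
by case: la {ra ia} => ? ?; case: lb {rb ib}.
Qed.

End ImproperFTC.

(** * Moments of the weight *)

Section ConjugateTranspose.
Local Open Scope complex_scope.
Local Open Scope sesquilinear_scope.
Context {R : realType} {N : nat}.
Local Notation C := R[i].
Local Notation M := 'M[R[i]]_N.+1.

(** A named map, so that it can carry the additive structure that [hankel_form] expects of its
    anti-involution. *)
Definition adjmx (A : M) : M := A^t*.

Lemma adjmxE A i j : adjmx A i j = ((A j i)^*)%R.
Proof. by rewrite !mxE. Qed.

Fact adjmx_is_zmod_morphism : zmod_morphism adjmx.
Proof. by move=> A B; apply/matrixP => i j; rewrite !mxE rmorphB. Qed.

HB.instance Definition _ :=
  GRing.isZmodMorphism.Build M M adjmx adjmx_is_zmod_morphism.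

Lemma adjmx_mul (A B : M) : adjmx (A *m B) = adjmx B *m adjmx A.
Proof. by rewrite /adjmx trmx_mul map_mxM. Qed.

Lemma adjmxM (A B : M) : adjmx (A * B) = adjmx B * adjmx A.
Proof. exact: adjmx_mul. Qed.

Lemma adjmxK : involutive adjmx.
Proof. by move=> A; apply/matrixP => i j; rewrite !adjmxE conjCK. Qed.

(* Linear relations between functions, such as being the integral or the
   derivative, pass from the moments to their Hankel forms; the type S is unit
   when the second function is a mere value. *)
Lemma hankel_form_rel (T S : Type) (K : (T -> C) -> (S -> C) -> Prop)
    (X : T -> nat -> M) (Y : S -> nat -> M) :
  K (fun=> 0) (fun=> 0) ->
  (forall f g f' g', K f g -> K f' g' ->
     K (fun t => f t + f' t) (fun s => g s + g' s)) ->
  (forall c f g, K f g -> K (fun t => c * f t) (fun s => c * g s)) ->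
  (forall k i j, K (fun t => X t k i j) (fun s => Y s k i j)) ->
  forall p q i j, K (fun t => hankel_form adjmx (X t) p q i j)
                    (fun s => hankel_form adjmx (Y s) p q i j).
Proof.
move=> K0 KD KZ KXY p q i j.
have Ksum m (F : 'I_m -> T -> C) (G : 'I_m -> S -> C) :
    (forall k, K (F k) (G k)) ->
    K (fun t => \sum_(k < m) F k t) (fun s => \sum_(k < m) G k s).
  elim: m F G => [|m IHm] F G FG.
    under eq_fun do rewrite big_ord0.
    by under [X in K _ X]eq_fun do rewrite big_ord0.
  under eq_fun do rewrite big_ord_recr.
  under [X in K _ X]eq_fun do rewrite big_ord_recr.
  by apply: KD => //; exact: IHm.
rewrite /hankel_form.
under eq_fun do rewrite summxE.
under [X in K _ X]eq_fun do rewrite summxE.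
apply: (Ksum) => m.
under eq_fun do rewrite summxE.
under [X in K _ X]eq_fun do rewrite summxE.
apply: (Ksum) => o.
under eq_fun do rewrite mxE.
under [X in K _ X]eq_fun do rewrite mxE.
apply: (Ksum) => l.
under eq_fun do rewrite mulrC.
under [X in K _ X]eq_fun do rewrite mulrC.
apply: (KZ).
under eq_fun do rewrite mxE.
under [X in K _ X]eq_fun do rewrite mxE.
by apply: (Ksum) => k; exact: KZ.
Qed.

Lemma mxevalE (p : {poly M}) (z : C) :
  mxeval p z = \sum_(i < size p) z ^+ i *: p`_i.
Proof.
rewrite /mxeval horner_coef; apply: eq_bigr => i _.
by rewrite -rmorphXn /= -[_ * _]/(_ *m _) mul_mx_scalar.
Qed.

(** The bridge from integrands to Hankel forms: t is real, so t^j comes out of the adjoint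
    unconjugated. *)
Lemma mxeval_form (p q : {poly M}) (V : M) (t : R) :
  mxeval p t%:C *m V *m (mxeval q t%:C)^t* =
  hankel_form adjmx (fun k => t%:C ^+ k *: V) p q.
Proof.
rewrite !mxevalE -[_^t*]/(adjmx _) raddf_sum /= !mulmx_suml.
apply: eq_bigr => i _; rewrite mulmx_sumr; apply: eq_bigr => j _.
have -> : adjmx (t%:C ^+ j *: q`_j) = t%:C ^+ j *: adjmx q`_j.
  apply/matrixP => k l; rewrite !mxE rmorphM rmorphXn /=.
  by congr (_ ^+ _ * _); exact: conjc_real.
rewrite -scalemxAl -scalemxAl -scalemxAr scalerA -exprD.
by rewrite -[_ * _ * _]/(_ *m _ *m _) -scalemxAr -scalemxAl.
Qed.

End ConjugateTranspose.

Section Moments.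
Local Open Scope complex_scope.
Local Open Scope sesquilinear_scope.
Context {R : realType} {N : nat} (a b : \bar R) (W : R -> 'M[R]_N.+1).
Local Notation C := R[i].
Local Notation M := 'M[R[i]]_N.+1.
Local Notation mu := (@lebesgue_measure R).
Local Notation D := (ointerval a b).
Local Notation form := (hankel_form (@adjmx R N)).
Hypothesis ab : (a < b)%E.
Hypothesis weightW : is_weight a b W.

Let mD : measurable D. Proof. exact: measurable_ointerval. Qed.

Definition moment (phi : R -> C) (k : nat) : M :=
  mxintegral D (fun t => phi t *: (t%:C ^+ k *: complexmx (W t))).

Lemma scale_hankel_form (c : C) (X : nat -> M) p q :
  form (fun k => c *: X k) p q = c *: form X p q.
Proof.
rewrite scaler_sumr; apply: eq_bigr => i _; rewrite scaler_sumr.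
by apply: eq_bigr => j _; rewrite -scalerAr -scalerAl.
Qed.

Lemma moment_entryE (phi : C) (k : nat) (t : R) i j :
  (phi *: (t%:C ^+ k *: complexmx (W t))) i j =
  phi * (t ^+ k * W t i j)%:C.
Proof. by rewrite !mxE rmorphM rmorphXn. Qed.

Lemma moment_cintegrable phi k i j : bounded_multiplier D phi ->
  cintegrable D (fun t => (phi t *: (t%:C ^+ k *: complexmx (W t))) i j).
Proof.
move=> bphi; under eq_fun do rewrite moment_entryE.
by apply: bounded_multiplier_integrable => //; exact: weight_moments.
Qed.

Lemma hankel_form_moment phi p q i j : bounded_multiplier D phi ->
  let f t := form (fun k => phi t *: (t%:C ^+ k *: complexmx (W t))) p q i j in
  cintegrable D f /\ cintegral D f = form (moment phi) p q i j.
Proof.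
move=> bphi f; rewrite /f.
pose K (f : R -> C) (g : unit -> C) := cintegrable D f /\ cintegral D f = g tt.
apply: (@hankel_form_rel R N R unit K
  (fun t k => phi t *: (t%:C ^+ k *: complexmx (W t))) (fun=> moment phi)).
- by split; [exact: cintegrable0 | exact: cintegral0].
- move=> f1 g1 f2 g2 [if1 e1] [if2 e2]; split; first exact: cintegrableD.
  by rewrite cintegralD // e1 e2.
- move=> c f1 g1 [if1 e1]; split; first exact: cintegrableZ.
  by rewrite cintegralZ // e1.
- by move=> k i' j'; split; [exact: moment_cintegrable | rewrite mxE].
Qed.

Lemma bounded_multiplier1 : bounded_multiplier D (fun=> 1 : C).
Proof.
by exists 1; split; [exact: measurable_cst | exact: measurable_cst |
  move=> t _; rewrite normr1].
Qed.

Lemma weight_integrandE p q t :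
  mxeval p t%:C *m complexmx (W t) *m (mxeval q t%:C)^t* =
  form (fun k => 1 *: (t%:C ^+ k *: complexmx (W t))) p q.
Proof. by rewrite mxeval_form scale_hankel_form scale1r. Qed.

Lemma weight_form_cintegrable p q i j : cintegrable D (fun t =>
  (mxeval p t%:C *m complexmx (W t) *m (mxeval q t%:C)^t*) i j).
Proof.
under eq_fun do rewrite weight_integrandE.
by have [] := hankel_form_moment p q i j bounded_multiplier1.
Qed.

Lemma weight_formE p q :
  weight_form a b W p q = form (moment (fun=> 1)) p q.
Proof.
apply/matrixP => i j; rewrite mxE.
have [_ <-] := hankel_form_moment p q i j bounded_multiplier1.
by apply: eq_cintegral => t _; rewrite weight_integrandE.
Qed.

Lemma cauchy_integrandE (V : R -> 'M[R]_N.+1) p q z t :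
  cauchy_integrand V p q z t =
  form (fun k => (t%:C - z)^-1 *: (t%:C ^+ k *: complexmx (V t))) p q.
Proof. by rewrite /cauchy_integrand mxeval_form scale_hankel_form. Qed.

Let res (z : C) (t : R) : C := (t%:C - z)^-1.
Let res2 (z : C) (t : R) : C := (t%:C - z)^-1 * (t%:C - z)^-1.

Lemma slit_plane_neq0 z t : slit_plane a b z -> D t -> t%:C - z != 0.
Proof.
move=> /(slit_plane_dist ab)[d d0 dz] Dt.
by rewrite -normr_gt0 (lt_le_trans _ (dz _ Dt)) // ltcR.
Qed.

Lemma bounded_multiplier_res z : slit_plane a b z ->
  bounded_multiplier D (res z).
Proof.
move=> /(slit_plane_dist ab)[d d0 dz].
by apply: bounded_multiplier_resolvent d0 dz; exact: open_ointerval.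
Qed.

(** To differentiate the Cauchy transform at z, its expression by moments is needed on a whole
    neighbourhood of z. *)
Lemma near_bounded_multiplier_res z : slit_plane a b z ->
  \forall w \near (z : C^o), bounded_multiplier D (res w).
Proof.
move=> /(slit_plane_dist ab)[d d0 dz]; have d20 : 0 < d / 2 by rewrite divr_gt0.
have d20C : 0 < (d / 2)%:C by rewrite ltcR.
near=> w; apply: (bounded_multiplier_resolvent (@open_ointerval R a b) d20) =>
  t Dt.
have zw : `|w - z| < (d / 2)%:C.
  by rewrite distrC; near: w; apply/nbhs_ballP; exists (d / 2)%:C.
have := lerB (dz _ Dt) (ltW zw); rewrite -rmorphB (_ : d - d / 2 = d / 2);
  last by field.
move=> /le_trans; apply; rewrite (_ : t%:C - w = t%:C - z - (w - z));
  last by ring.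
exact: lerB_dist.
Unshelve. all: by end_near. Qed.

Lemma bounded_multiplier_res2 z : slit_plane a b z ->
  bounded_multiplier D (res2 z).
Proof. by move=> zab; apply: bounded_multiplierM;
  exact: bounded_multiplier_res. Qed.

Lemma adj_mxeval1 t : (mxeval (1 : {poly M}) t)^t* = 1.
Proof.
by rewrite /mxeval hornerC -[_^t*]/(adjmx _) (star1 (@adjmxM R N) (@adjmxK R
  N)).
Qed.

Lemma cauchy_transformE p z : bounded_multiplier D (res z) ->
  cauchy_transform a b (fun t => mxeval p t%:C *m complexmx (W t)) z =
  (two_pi_i R)^-1 *: form (moment (res z)) p 1.
Proof.
move=> bz; congr (_ *: _); apply/matrixP => i j; rewrite mxE.
have [_ <-] := hankel_form_moment p 1 i j bz.
apply: eq_cintegral => t _; rewrite scale_hankel_form -mxeval_form.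
by rewrite adj_mxeval1 mulmx1.
Qed.

(** From t phi = z phi + (t - z) phi; dividing by t - z once or twice gives the recurrences of both
    Cauchy moments. *)
Lemma moment_shift (phi psi : R -> C) (z : C) k :
  bounded_multiplier D phi -> bounded_multiplier D psi ->
  (forall t, D t -> phi t * (t%:C - z) = psi t) ->
  moment phi k.+1 = z%:M * moment phi k + moment psi k.
Proof.
move=> bphi bpsi shift; apply/matrixP => i j.
rewrite -[_ * _]/(_ *m _) mul_scalar_mx !mxE -cintegralZ //;
  last exact: moment_cintegrable.
rewrite -cintegralD //; try exact: moment_cintegrable; last first.
  by apply: cintegrableZ => //; exact: moment_cintegrable.
apply: eq_cintegral => t Dt; rewrite !mxE -(shift t Dt) exprS.
ring.
Qed.

Lemma adj_moment phi k : bounded_multiplier D phi ->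
  adjmx (moment phi k) = moment (fun t => ((phi t)^*)%R) k.
Proof.
move=> bphi; apply/matrixP => i j; rewrite adjmxE !mxE conj_cintegral //;
  last exact: moment_cintegrable.
apply: eq_cintegral => t Dt; rewrite !moment_entryE rmorphM.
congr (_ * _); rewrite -[LHS]/(conjc _) conjc_real.
have [sym _] := weight_posdef weightW Dt.
by rewrite -[in LHS]sym mxE.
Qed.

Lemma is_derive_moment z k i j : slit_plane a b z ->
  is_derive (z : C^o) 1 (fun w : C^o => moment (res w) k i j : C^o)
    (moment (res2 z) k i j).
Proof.
move=> /(slit_plane_dist ab)[d d0 dz].
have iv : mu.-integrable D (EFin \o (fun t => t ^+ k * W t i j)).
  exact: weight_moments.
have := is_derive_cauchy_integral (@open_ointerval R a b) iv d0 dz.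
have E (phi : R -> C) : moment phi k i j =
    cintegral D (fun t => phi t * (t ^+ k * W t i j)%:C).
  by rewrite mxE; apply: eq_cintegral => t _; rewrite moment_entryE.
by rewrite E; under [in X in _ -> X]eq_fun do rewrite E.
Qed.

End Moments.

(** * Complex functions of a real variable *)

Section ComplexDerivative.
Local Open Scope complex_scope.
Local Open Scope sesquilinear_scope.
Context {R : realType}.
Implicit Types (F G : R -> R[i]) (f g c z : R[i]) (t : R).

(** Stated by real and imaginary parts, the form in which the real fundamental theorem consumes
    it. *)
Definition is_cderive t F f :=
  is_derive t 1 (fun s => complex.Re (F s)) (complex.Re f) /\
  is_derive t 1 (fun s => complex.Im (F s)) (complex.Im f).

Lemma is_cderive0 t : is_cderive t (fun=> 0) 0.
Proof. by split; exact: is_derive_cst. Qed.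

Lemma is_cderiveD t F G f g : is_cderive t F f -> is_cderive t G g ->
  is_cderive t (fun s => F s + G s) (f + g).
Proof.
move=> [F1 F2] [G1 G2]; split; rewrite ?Re_addc ?Im_addc.
  by under eq_fun do rewrite Re_addc; exact: is_deriveD.
by under eq_fun do rewrite Im_addc; exact: is_deriveD.
Qed.

Let is_deriveMr (u v : R -> R) (du dv t : R) :
  is_derive t 1 u du -> is_derive t 1 v dv ->
  is_derive t 1 (fun s => u s * v s) (u t * dv + du * v t).
Proof.
by move=> hu hv; have := is_deriveM hu hv;
  rewrite -![_ *: _]/(_ * _) [v t * _]mulrC.
Qed.

Lemma is_cderiveM t F G f g : is_cderive t F f -> is_cderive t G g ->
  is_cderive t (fun s => F s * G s) (F t * g + f * G t).
Proof.
move=> [F1 F2] [G1 G2]; split; rewrite ?Re_addc ?Im_addc ?Re_mulc ?Im_mulc.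
  under eq_fun do rewrite Re_mulc.
  have := is_deriveB (is_deriveMr F1 G1) (is_deriveMr F2 G2).
  by rewrite opprD addrACA.
under eq_fun do rewrite Im_mulc.
have := is_deriveD (is_deriveMr F1 G2) (is_deriveMr F2 G1).
by rewrite addrACA.
Qed.

Lemma is_cderiveZ t c F f : is_cderive t F f ->
  is_cderive t (fun s => c * F s) (c * f).
Proof.
move=> dF; have dc : is_cderive t (fun=> c) 0 by split; exact: is_derive_cst.
by have := is_cderiveM dc dF; rewrite mul0r addr0.
Qed.

Lemma is_cderive_real t (u : R -> R) (du : R) : is_derive t 1 u du ->
  is_cderive t (fun s => (u s)%:C) du%:C.
Proof. by move=> du'; split => //=; exact: is_derive_cst. Qed.

Lemma is_cderive_resolvent t z : t%:C - z != 0 ->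
  is_cderive t (fun s => (s%:C - z)^-1) (- ((t%:C - z)^-1 * (t%:C - z)^-1)).
Proof.
case: z => x y tz; pose n (s : R) := (s - x) ^+ 2 + (0 - y) ^+ 2.
have n0 : n t != 0.
  apply: contra tz; rewrite paddr_eq0 ?sqr_ge0 // !sqrf_eq0 => /andP[tx y0].
  by rewrite eq_complex /= tx.
have dx : is_derive t 1 (fun s => s - x) 1.
  by have := is_deriveB (is_derive_id t 1) (is_derive_cst x t 1); rewrite subr0.
have dn : is_derive t 1 n (2 * (t - x)).
  apply: is_derive_eq (is_deriveD (is_deriveMr dx dx) (is_derive_cst ((0 - y)
    ^+ 2) t 1)) _.
  ring.
have dV : is_derive t 1 (fun s => (n s)^-1) (- (n t) ^- 2 * (2 * (t - x))).
  exact: is_deriveV.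
have dRe : is_derive t 1 (fun s => (s - x) * (n s)^-1)
    (complex.Re (- ((t%:C - x +i* y)^-1 * (t%:C - x +i* y)^-1))).
  apply: is_derive_eq (is_deriveMr dx dV) _.
  rewrite /= -/(n t); move: n0; rewrite /n => n0; field.
  by move: n0; rewrite sub0r.
have dIm : is_derive t 1 (fun s => - ((0 - y) * (n s)^-1))
    (complex.Im (- ((t%:C - x +i* y)^-1 * (t%:C - x +i* y)^-1))).
  apply: is_derive_eq (is_deriveN (is_deriveMr (is_derive_cst (0 - y) t 1)
    dV)) _.
  rewrite /= -/(n t); move: n0; rewrite /n => n0; field.
  by move: n0; rewrite sub0r.
by split; [exact: dRe | exact: dIm].
Qed.

End ComplexDerivative.

(** * Invertibility of the matrices h_k *)

Section Positivity.
Local Open Scope complex_scope.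
Local Open Scope sesquilinear_scope.
Context {R : realType} {N : nat} (a b : \bar R) (W : R -> 'M[R]_N.+1).
Local Notation C := R[i].
Local Notation M := 'M[R[i]]_N.+1.
Local Notation mu := (@lebesgue_measure R).
Local Notation D := (ointerval a b).
Hypothesis ab : (a < b)%E.
Hypothesis weightW : is_weight a b W.

(** With x = x1 + i x2, the mixed terms are purely imaginary, so the real part is the sum of the
    values of the form at x1 and x2. *)
Lemma posdef_complex (n : nat) (V : 'M[R]_n) (x : 'rV[C]_n) : posdefmx V ->
  0 <= complex.Re ((x *m complexmx V *m x^t*) 0 0) /\
  (x != 0 -> 0 < complex.Re ((x *m complexmx V *m x^t*) 0 0)).
Proof.
move=> [_ posV].
pose x1 : 'rV[R]_n := \row_j complex.Re (x 0 j).
pose x2 : 'rV[R]_n := \row_j complex.Im (x 0 j).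
have ReE : complex.Re ((x *m complexmx V *m x^t*) 0 0) =
    (x1 *m V *m x1^T) 0 0 + (x2 *m V *m x2^T) 0 0.
  rewrite !mxE (big_morph _ (@Re_addc R) (erefl :
    complex.Re 0 = 0)) -big_split /=.
  apply: eq_bigr => l _; rewrite !mxE !mulr_suml -big_split /=.
  rewrite (big_morph _ (@Re_addc R) (erefl : complex.Re 0 = 0)).
  apply: eq_bigr => k _; rewrite !mxE; case: (x 0 k) => u v;
    case: (x 0 l) => u' v' /=.
  ring.
have pos0 (v : 'rV[R]_n) : 0 <= (v *m V *m v^T) 0 0.
  have [->|/posV/ltW//] := eqVneq v 0; by rewrite !mul0mx mxE.
rewrite ReE; split; first by rewrite addr_ge0.
move=> x0; have [x10|/posV x10] := eqVneq x1 0; last by rewrite ltr_pwDl.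
have [x20|/posV x20] := eqVneq x2 0; last by rewrite ltr_pwDr // posV.
case/eqP: x0; apply/rowP => j; rewrite mxE; apply/eqP; rewrite eq_complex /=.
have := congr1 (fun u : 'rV[R]_n => u 0 j) x10; rewrite !mxE => ->.
by have := congr1 (fun u : 'rV[R]_n => u 0 j) x20; rewrite !mxE => ->;
  rewrite !eqxx.
Qed.

Lemma ointerval_not_negligible : ~ mu.-negligible D.
Proof.
have [m Dm] := ointerval_nonempty ab.
move=> [A [mA A0 DA]].
have /nbhs_ballP[e /= e0 eD] : nbhs m D.
  by apply: open_nbhs_nbhs; split => //; exact: open_ointerval.
have : (mu (ball m e) <= mu A)%E.
  apply: le_measure; rewrite ?inE //; first exact: measurable_ball.
  exact: subset_trans eD DA.
rewrite [X in (_ <= X)%E]A0 (lebesgue_measure_ball _ (ltW e0)).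
by rewrite leNgt lte_fin mulrn_wgt0.
Qed.

(** A left null vector v makes the integral of (v p) W (v p)^* vanish. Its integrand is nonnegative,
    so it is 0 almost everywhere, and there v p(t) = 0. As p is monic, some entry of v p is a
    nonzero polynomial, with finitely many roots, while the interval is not a null set. *)
Lemma weight_form_unit (p : {poly M}) : p \is monic ->
  weight_form a b W p p \in unitmx.
Proof.
move=> monp; rewrite -row_free_unit; apply: inj_row_free => v vh.
apply/eqP; apply: contrapT => /negP/rV0Pn[j vj].
(* Coefficients are square matrices, so the row v is repeated; only entry (0, 0) of the form is
   looked at. *)
pose A : M := \matrix_(i, k) v 0 k; pose q := A *: p.
have Ah : A *m weight_form a b W p p = 0.
  apply/row_matrixP => i; rewrite row_mul row0.
  by rewrite (_ : row i A = v) //; apply/rowP => k; rewrite !mxE.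
have q0 : weight_form a b W q q = 0.
  rewrite weight_formE // hankel_formZl.
  rewrite (hankel_formZr (@adjmxM R N) (@adjmxK R N)) mulrA -weight_formE //.
  by rewrite -[_ * weight_form _ _ _ _ _]/(_ *m _) Ah mul0r.
pose s (t : R) := complex.Re ((mxeval q t%:C *m complexmx (W t) *m (mxeval q
  t%:C)^t*) 0 0).
have sE t : s t = complex.Re ((row 0 (mxeval q t%:C) *m complexmx (W t) *m
   (row 0 (mxeval q t%:C))^t*) 0 0).
  rewrite /s -row_mul; congr complex.Re.
  rewrite [LHS]mxE [RHS]mxE; apply: eq_bigr => k _.
  by congr (_ * _); rewrite !mxE.
have int_s : \int[mu]_(t in D) s t = 0.
  by have := congr1 (fun B : M => complex.Re (B 0 0)) q0; rewrite !mxE.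
have is_ : mu.-integrable D (EFin \o s).
  by have [] := weight_form_cintegrable weightW q q 0 0.
have s_ge0 t : D t -> 0 <= s t.
  move=> Dt; rewrite sE.
  by case: (posdef_complex (row 0 (mxeval q t%:C)) (weight_posdef weightW Dt)).
have mD : measurable D by exact: measurable_ointerval.
have int_s0 : (\int[mu]_(t in D) (s t)%:E = 0)%E.
  by rewrite -[LHS]fineK ?integrable_fin_num //; congr EFin.
have s_ae : ae_eq mu D (EFin \o s) (cst 0%E).
  apply/ae_eq_integral_abs => //; first exact: measurable_int is_.
  rewrite -[RHS]int_s0; apply: eq_integral => t /set_mem Dt.
  by rewrite /= ger0_norm // s_ge0.
(* Entry (0, j) of [q] as a scalar polynomial; its coefficient at the degree of the monic [p] is the
   nonzero entry j of v. *)
pose r : {poly C} := \poly_(k < size q) (q`_k 0 j).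
have r0 : r != 0.
  have qn : q`_(size p).-1 0 j = v 0 j.
    by rewrite coefZ -lead_coefE (monicP monp) mulr1 mxE.
  apply/eqP => /(congr1 (fun u : {poly C} => u`_(size p).-1)).
  rewrite coef_poly coef0; case: ltnP => [_|/(nth_default 0) qn0 _].
    by apply/eqP; rewrite qn.
  by move: vj; rewrite -qn qn0 mxE eqxx.
have root_r t : D t -> s t = 0 -> root r t%:C.
  move=> Dt st; rewrite /root horner_poly.
  have [u0|u0] := eqVneq (row 0 (mxeval q t%:C)) 0; last first.
    have [_ /(_ u0)] := posdef_complex (row 0 (mxeval q t%:C)) (weight_posdef
      weightW Dt).
    by rewrite -sE st ltxx.
  have := congr1 (fun u : 'rV[C]_N.+1 => u 0 j) u0.
  rewrite mxE mxevalE summxE mxE => u0j; apply/eqP; rewrite -[RHS]u0j.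
  by under [RHS]eq_bigr do rewrite mxE mulrC.
apply: ointerval_not_negligible.
have [rs rE] := closed_field_poly_normal r.
pose Z : set R := [set t | root r t%:C].
have Z0 : mu.-negligible Z.
  have cZ : countable Z.
    apply: finite_set_countable;
      apply: (@sub_finite_set _ _ [set` [seq complex.Re x | x <- rs]]).
      move=> t; rewrite /Z /= rE rootZ ?lead_coef_eq0 // root_prod_XsubC => trs.
      by apply/mapP; exists t%:C.
    exact: finite_seq.
  exists Z; split => //; first exact: countable_measurable.
  exact: countable_lebesgue_measure0.
apply: negligibleS (negligibleU s_ae Z0) => t Dt.
have [st0|st0] := eqVneq (s t) 0; first by right; exact: root_r.
by left => /= /(_ Dt) [] /eqP; rewrite (negbTE st0).
Qed.

End Positivity.

(** * Integration by parts *)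

Section Bracket.
Local Open Scope complex_scope.
Local Open Scope sesquilinear_scope.
Context {R : realType} {N : nat} (a b : \bar R) (W : R -> 'M[R]_N.+1).
Local Notation C := R[i].
Local Notation M := 'M[R[i]]_N.+1.
Local Notation mu := (@lebesgue_measure R).
Local Notation D := (ointerval a b).
Local Notation form := (hankel_form (@adjmx R N)).
Hypothesis ab : (a < b)%E.
Hypothesis weightW : is_weight a b W.

Definition cauchy_moment (z : C) : nat -> M :=
  moment a b W (fun t => (t%:C - z)^-1).
Definition cauchy_moment2 (z : C) : nat -> M :=
  moment a b W (fun t => (t%:C - z)^-1 * (t%:C - z)^-1).

Lemma is_derive_power_weight k i j t : D t ->
  is_derive t 1 (fun s => s ^+ k * W s i j)
    (k%:R * t ^+ k.-1 * W t i j + t ^+ k * derive1 W t i j).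
Proof.
move=> Dt; have dW := weight_derivable weightW Dt.
have dWij : is_derive t 1 (fun s => W s i j) (derive1 W t i j).
  have /derivableP := (derivable_mxP W t 1).1 dW i j.
  by rewrite derive1E derive_mx // mxE.
have dX : is_derive t 1 (fun s : R => s ^+ k) (k%:R * t ^+ k.-1).
  by have := is_deriveX k (is_derive_id t (1 : R));
    rewrite exprfctE [_ *: 1]mulr1.
apply: is_derive_eq (is_deriveM dX dWij) _.
by rewrite -![_ *: _]/(_ * _) addrC [W t i j * _]mulrC.
Qed.

(** The product rule is used on t^k W(t)/(t - z) only. The term k t^(k-1) becomes the derivatives of
    p and q through [hankel_form_deriv], and -1 is the sign from differentiating the resolvent. *)
Lemma is_cderive_cauchy_integrand p q z t i j : slit_plane a b z -> D t ->
  is_cderive t (fun s => cauchy_integrand W p q z s i j)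
   (cauchy_integrand (derive1 W) p q z t i j +
    (form (fun k => (t%:C - z)^-1 *: (t%:C ^+ k *: complexmx (W t))) p^`() q i
      j +
     form (fun k => (t%:C - z)^-1 *: (t%:C ^+ k *: complexmx (W t))) p q^`() i
       j +
     -1 * form (fun k => ((t%:C - z)^-1 * (t%:C - z)^-1) *:
       (t%:C ^+ k *: complexmx (W t))) p q i j)).
Proof.
move=> zab Dt.
pose X (s : R) k : M := (s%:C - z)^-1 *: (s%:C ^+ k *: complexmx (W s)).
pose X2 k : M := ((t%:C - z)^-1 * (t%:C - z)^-1) *: (t%:C ^+ k *: complexmx (W
  t)).
pose X' k : M := (t%:C - z)^-1 *: (t%:C ^+ k *: complexmx (derive1 W t)).
pose K (F : R -> C) (f : unit -> C) := is_cderive t F (f tt).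
rewrite (_ : (fun s => _) = (fun s => form (X s) p q i j)); last first.
  by apply/funext => s; rewrite cauchy_integrandE.
rewrite [X in is_cderive _ _ X](_ : _ =
    form (fun k => X' k + (X t k.-1 *+ k + - X2 k)) p q i j); last first.
  rewrite hankel_formDm (hankel_formDm _ (fun k => X t k.-1 *+ k)).
  rewrite hankel_formNm hankel_form_deriv cauchy_integrandE.
  rewrite [RHS]mxE [X in _ = _ + X]mxE [X in _ = _ + (X + _)]mxE.
  by rewrite [X in _ = _ + (_ + X)]mxE mulN1r.
apply: (@hankel_form_rel R N R unit K X
  (fun _ k => X' k + (X t k.-1 *+ k + - X2 k))); rewrite /K.
- exact: is_cderive0.
- by move=> F f G g; exact: is_cderiveD.
- by move=> c F f; exact: is_cderiveZ.
move=> k i' j'; rewrite /X; under eq_fun do rewrite moment_entryE.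
have := is_cderiveM (is_cderive_resolvent (slit_plane_neq0 ab zab Dt))
  (is_cderive_real (is_derive_power_weight k i' j' Dt)).
congr is_cderive; rewrite !mxE mulmxnE !mxE.
rewrite -mulr_natl !rmorphD !rmorphM !rmorphXn /= rmorph_nat.
ring.
Qed.

(** Existence of the bracket provides the boundary limits and integrability of the W' term; the
    other terms of the derivative are integrable by the finite moments of W. *)
Lemma bracketE p q z : slit_plane a b z -> bracket_exists a b W p q ->
  bracket a b W p q z =
  hankel_bracket (@adjmx R N) (cauchy_moment z) (cauchy_moment2 z) p q.
Proof.
move=> zab ex; apply/matrixP => i j; have [ig cb ca] := ex z zab i j.
have b1 := bounded_multiplier_res ab zab.
have b2 := bounded_multiplier_res2 ab zab.
have [i1 e1] := hankel_form_moment weightW p^`() q i j b1.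
have [i2 e2] := hankel_form_moment weightW p q^`() i j b1.
have [i3 e3] := hankel_form_moment weightW p q i j b2.
have mD := measurable_ointerval a b.
have i12 := cintegrableD mD i1 i2.
have i3N := cintegrableZ mD (-1) i3.
have i123 := cintegrableD mD i12 i3N.
have := cFTC2_ointerval ab
  (fun t Dt => is_cderive_cauchy_integrand p q i j zab Dt)
  (cintegrableD mD ig i123) ca cb.
rewrite cintegralD // cintegralD // cintegralD // cintegralZ // e1 e2 e3.
rewrite /bracket /hankel_bracket => E.
rewrite [LHS]mxE [X in X + _ = _]mxE [X in _ + X = _]mxE.
rewrite [X in _ - X = _]mxE [X in _ - (X + _) = _]mxE [X in _ - (_ + X) = _]mxE.
rewrite [X in _ - (_ - X) = _]mxE -E [RHS]mxE [X in _ = _ + X]mxE [X in _ =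
  _ - X]mxE.
rewrite mulN1r; ring.
Qed.

End Bracket.

(** * The ladder equation *)

Section MatrixDerivative.
Local Open Scope complex_scope.
Local Open Scope sesquilinear_scope.
Context {R : realType}.
Local Notation C := R[i].

Definition is_mxderive (m n : nat) (z : C) (F : C ->
  'M[C]_(m, n)) (F' : 'M[C]_(m, n)) :=
  forall i j, is_derive (z : C^o) 1 (fun w : C^o => F w i j : C^o) (F' i j).

Lemma is_derive_scale (z c : C) (F : C -> C) (f : C) :
  is_derive (z : C^o) 1 (fun w : C^o => F w : C^o) f ->
  is_derive (z : C^o) 1 (fun w : C^o => c * F w : C^o) (c * f).
Proof.
move=> dF; have := is_deriveM (is_derive_cst (c : C^o) (z : C^o) 1) dF.
by rewrite scaler0 addr0.
Qed.

Lemma is_mxderiveZ m n z c (F : C -> 'M[C]_(m, n)) F' : is_mxderive z F F' ->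
  is_mxderive z (fun w => c *: F w) (c *: F').
Proof.
move=> dF i j; rewrite mxE; under eq_fun do rewrite mxE.
exact: is_derive_scale.
Qed.

Lemma is_mxderive_mull m n p z (A : 'M[C]_(m, n)) (F : C -> 'M[C]_(n, p)) F' :
  is_mxderive z F F' -> is_mxderive z (fun w => A *m F w) (A *m F').
Proof.
move=> dF i j; rewrite mxE; under eq_fun do rewrite mxE.
have := is_derive_sum (fun k => is_derive_scale (A i k) (dF k j)).
by rewrite fct_sumE.
Qed.

Lemma is_mxderive_block m1 m2 n1 n2 z
    (F1 : C -> 'M[C]_(m1, n1)) (F2 : C -> 'M[C]_(m1, n2))
    (F3 : C -> 'M[C]_(m2, n1)) (F4 : C -> 'M[C]_(m2, n2)) G1 G2 G3 G4 :
  is_mxderive z F1 G1 -> is_mxderive z F2 G2 ->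
  is_mxderive z F3 G3 -> is_mxderive z F4 G4 ->
  is_mxderive z (fun w => block_mx (F1 w) (F2 w) (F3 w) (F4 w)) (block_mx G1
    G2 G3 G4).
Proof.
move=> d1 d2 d3 d4 i j; case: (split_ordP i) => i' ->;
  case: (split_ordP j) => j' ->.
- by rewrite block_mxEul; under eq_fun do rewrite block_mxEul.
- by rewrite block_mxEur; under eq_fun do rewrite block_mxEur.
- by rewrite block_mxEdl; under eq_fun do rewrite block_mxEdl.
- by rewrite block_mxEdr; under eq_fun do rewrite block_mxEdr.
Qed.

Lemma near_is_mxderive m n (z : C) (F G : C -> 'M[C]_(m, n)) F' :
  (\forall w \near (z : C^o), F w = G w) -> is_mxderive z F F' ->
    is_mxderive z G F'.
Proof.
move=> FG dF i j; apply: near_eq_is_derive (dF i j).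
by apply: filterS FG => w ->.
Qed.

Lemma is_mxderive_hankel (N : nat) (z : C) (X : C -> nat -> 'M[C]_N.+1) X' p q :
  (forall k, is_mxderive z (X^~ k) (X' k)) ->
  is_mxderive z (fun w => hankel_form (@adjmx R N) (X w) p q)
    (hankel_form (@adjmx R N) X' p q).
Proof.
move=> dX i j.
pose K (F : C -> C) (f : unit -> C) :=
  is_derive (z : C^o) 1 (fun w : C^o => F w : C^o) (f tt).
apply: (@hankel_form_rel R N C unit K X (fun _ => X')); rewrite /K.
- exact: is_derive_cst.
- by move=> F f G g; exact: is_deriveD.
- by move=> c F f; exact: is_derive_scale.
- by move=> k i' j'; exact: dX.
Qed.

(** Evaluation is itself a Hankel form, with moments z^k I, so both columns of Y are differentiated
    by [is_mxderive_hankel]. *)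
Lemma mxeval_hankel (N : nat) (p : {poly 'M[C]_N.+1}) z :
  mxeval p z = hankel_form (@adjmx R N) (fun k => z ^+ k *: 1) p 1.
Proof.
rewrite mxevalE /hankel_form size_poly1; apply: eq_bigr => i _.
rewrite big_ord1 addn0 -polyC1 coefC eqxx (star1 (@adjmxM R N) (@adjmxK R N)).
by rewrite mulr1 -[_ * _]/(_ *m _) -scalemxAr mulmx1.
Qed.

Lemma is_mxderive_mxeval (N : nat) (p : {poly 'M[C]_N.+1}) z :
  is_mxderive z (mxeval p) (mxeval p^`() z).
Proof.
rewrite (_ : mxeval p = fun w => hankel_form (@adjmx R N) (fun k =>
  w ^+ k *: 1) p 1);
  last by apply/funext => w; rewrite mxeval_hankel.
have -> : mxeval p^`() z =
    hankel_form (@adjmx R N) (fun k => (z ^+ k.-1 *: 1) *+ k) p 1.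
  rewrite (hankel_form_deriv (@adjmx R N) (fun k => z ^+ k *: 1)).
  by rewrite mxeval_hankel -polyC1 derivC hankel_form0r addr0.
apply: is_mxderive_hankel => k i j; rewrite mulmxnE mxE.
under eq_fun do rewrite mxE mulrC.
have dX : is_derive (z : C^o) 1 (fun w : C^o =>
  w ^+ k : C^o) (k%:R * z ^+ k.-1).
  by have := is_deriveX k (is_derive_id (z : C^o) (1 : C^o));
    rewrite exprfctE [_ *: 1]mulr1.
have := is_derive_scale ((1 : 'M[C]_N.+1) i j) dX.
by rewrite mulrC -mulrA mulr_natl.
Qed.

End MatrixDerivative.

Section OrthogonalPolynomials.
Local Open Scope complex_scope.
Local Open Scope sesquilinear_scope.
Context {R : realType} {N : nat} (a b : \bar R) (W : R -> 'M[R]_N.+1)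
  (P : nat -> {poly 'M[R[i]]_N.+1}).
Local Notation C := R[i].
Local Notation M := 'M[R[i]]_N.+1.
Local Notation D := (ointerval a b).
Local Notation adj := (@adjmx R N).
Local Notation form := (hankel_form adj).
Hypothesis ab : (a < b)%E.
Hypothesis weightW : is_weight a b W.
Hypothesis orthoP : forall k : nat, is_monic_orthogonal a b W k (P k).

Local Notation M0 := (moment a b W (fun=> 1)).
Local Notation M1 := (cauchy_moment a b W).
Local Notation M2 := (cauchy_moment2 a b W).
Local Notation h k := (form M0 (P k) (P k)).
Local Notation br z p q := (hankel_bracket adj (M1 z) (M2 z) p q).

Let adjM := @adjmxM R N.
Let adjK := @adjmxK R N.

Lemma adj_moment0 k : adj (M0 k) = M0 k.
Proof.
rewrite (adj_moment weightW k (bounded_multiplier1 a b)).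
by congr (moment _ _ _ _ k); apply/funext => t; rewrite conjC1.
Qed.

Let P_monic k : P k \is monic. Proof. by case: (orthoP k). Qed.
Let P_size k : size (P k) = k.+1. Proof. by case: (orthoP k). Qed.
Let P_orthogonal k (q : {poly M}) : (size q <= k)%N -> form M0 (P k) q = 0.
Proof. by move=> qk; rewrite -weight_formE //; case: (orthoP k) => _ _;
  apply. Qed.
Let h_unit k : h k \is a GRing.unit.
Proof. by rewrite -weight_formE //; exact: weight_form_unit. Qed.

Lemma gammaE k : gamma a b W P k = (h k)^-1.
Proof. by rewrite /gamma weight_formE. Qed.

Lemma gamma_unit k : gamma a b W P k \in unitmx.
Proof. by rewrite gammaE unitmx_inv; exact: h_unit. Qed.

Lemma adj_gamma k : adj (gamma a b W P k) = gamma a b W P k.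
Proof. rewrite gammaE; exact: (star_inv_h adjM adjK adj_moment0 h_unit). Qed.

Lemma conj_resolvent (z : C) (t : R) :
  (((t%:C - (z^*)%R)^-1)^*)%R = (t%:C - z)^-1.
Proof.
rewrite fmorphV rmorphB /= conjCK; congr (_ - _)^-1; exact: conjc_real.
Qed.

(** W is real symmetric and t is real, so the adjoint conjugates only z, and the conjugate argument
    in F^* undoes this. The swap of p and q is how br(P_(n-1), P_n) is obtained from frakB. *)
Lemma adj_bracket z p q : slit_plane a b z ->
  adj (br (z^*)%R p q) = br z q p.
Proof.
move=> zab; have zab' := slit_plane_conj zab.
have E1 : adj \o M1 (z^*)%R = M1 z.
  apply/funext => k /=; rewrite /cauchy_moment.
  rewrite (adj_moment weightW k (bounded_multiplier_res ab zab')).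
  by congr (moment _ _ _ _ k); apply/funext => t; exact: conj_resolvent.
have E2 : adj \o M2 (z^*)%R = M2 z.
  apply/funext => k /=; rewrite /cauchy_moment2.
  rewrite (adj_moment weightW k (bounded_multiplier_res2 ab zab')).
  congr (moment _ _ _ _ k); apply/funext => t.
  by rewrite rmorphM /= conj_resolvent.
by rewrite (star_hankel_bracket adjM adjK) E1 E2.
Qed.

Lemma cauchy_momentS z k : slit_plane a b z -> M1 z k.+1 = z%:M * M1 z k + M0 k.
Proof.
move=> zab; apply: moment_shift => //.
- exact: bounded_multiplier_res.
- exact: bounded_multiplier1.
- by move=> t Dt; rewrite mulVf // (slit_plane_neq0 ab zab Dt).
Qed.

Lemma cauchy_moment2S z k : slit_plane a b z ->
  M2 z k.+1 = z%:M * M2 z k + M1 z k.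
Proof.
move=> zab; apply: moment_shift => //.
- exact: bounded_multiplier_res2.
- exact: bounded_multiplier_res.
- by move=> t Dt; rewrite mulfVK // (slit_plane_neq0 ab zab Dt).
Qed.

Lemma scalar_central (z : C) (A : M) : z%:M * A = A * z%:M.
Proof. by symmetry; exact: scalar_mxC. Qed.

Lemma mxeval_ladder z n m : slit_plane a b z -> (n <= m <= n.+1)%N ->
  mxeval (P m)^`() z =
  br z (P m) (P n) *m gamma a b W P n *m mxeval (P n.+1) z -
  br z (P m) (P n.+1) *m gamma a b W P n *m mxeval (P n) z.
Proof.
rewrite gammaE => zab; exact: (ladder_horner adjM adjK adj_moment0 P_monic
  P_size
  P_orthogonal h_unit (@scalar_central z) (fun k => cauchy_momentS k zab)
  (fun k => cauchy_moment2S k zab)).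
Qed.

Lemma cauchy_ladder z n m : slit_plane a b z -> (n <= m <= n.+1)%N ->
  form (M2 z) (P m) 1 =
  br z (P m) (P n) *m gamma a b W P n *m form (M1 z) (P n.+1) 1 -
  br z (P m) (P n.+1) *m gamma a b W P n *m form (M1 z) (P n) 1.
Proof.
rewrite gammaE => zab; exact: (ladder_cauchy adjM adjK adj_moment0 P_monic
  P_size
  P_orthogonal h_unit (@scalar_central z) (fun k => cauchy_momentS k zab)
  (fun k => cauchy_moment2S k zab)).
Qed.

Lemma cauchy_transform_moment z p : slit_plane a b z ->
  cauchy_transform a b (fun t => mxeval p t%:C *m complexmx (W t)) z =
  (two_pi_i R)^-1 *: form (M1 z) p 1.
Proof.
move=> zab; exact: (cauchy_transformE weightW p (bounded_multiplier_res ab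
  zab)).
Qed.

Lemma is_mxderive_cauchy_transform z p : slit_plane a b z ->
  is_mxderive z
    (cauchy_transform a b (fun t => mxeval p t%:C *m complexmx (W t)))
    ((two_pi_i R)^-1 *: form (M2 z) p 1).
Proof.
move=> zab.
apply: (@near_is_mxderive _ _ _ _ (fun w =>
  (two_pi_i R)^-1 *: form (M1 w) p 1)).
  by apply: filterS (near_bounded_multiplier_res ab zab) => w bw;
    rewrite cauchy_transformE.
apply: is_mxderiveZ; apply: is_mxderive_hankel => k i j.
exact: is_derive_moment.
Qed.

Lemma is_mxderive_Ymx z n : slit_plane a b z ->
  is_mxderive z (Ymx a b W P n) (block_mx
    (mxeval (P n)^`() z)
    ((two_pi_i R)^-1 *: form (M2 z) (P n) 1)
    (- two_pi_i R *: (gamma a b W P n.-1 *m mxeval (P n.-1)^`() z))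
    (- two_pi_i R *: (gamma a b W P n.-1 *m
      ((two_pi_i R)^-1 *: form (M2 z) (P n.-1) 1)))).
Proof.
move=> zab; apply: is_mxderive_block.
- exact: is_mxderive_mxeval.
- exact: is_mxderive_cauchy_transform.
- by apply/is_mxderiveZ/is_mxderive_mull; exact: is_mxderive_mxeval.
- by apply/is_mxderiveZ/is_mxderive_mull; exact: is_mxderive_cauchy_transform.
Qed.

Lemma two_pi_i_neq0 : two_pi_i R != 0.
Proof.
rewrite /two_pi_i mulf_neq0 ?neq0Ci // fmorph_eq0 mulf_neq0 //.
by rewrite gt_eqF // pi_gt0.
Qed.

Lemma frakA_bracket z n : slit_plane a b z ->
  bracket_exists a b W (P n) (P n) ->
  frakA a b W P n z = - (gamma a b W P n *m br z (P n) (P n)).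
Proof. by move=> zab ex; rewrite /frakA bracketE. Qed.

Lemma star_frakB z n : slit_plane a b z ->
  bracket_exists a b W (P n) (P n.-1) ->
  star (frakB a b W P n) z = - (gamma a b W P n.-1 *m br z (P n.-1) (P n)).
Proof.
move=> zab ex; rewrite /star /frakB bracketE //; last exact: slit_plane_conj.
rewrite -[_^t*]/(adj _) raddfN /=; congr (- _).
by rewrite adjmx_mul adj_gamma adj_bracket.
Qed.

Lemma star_frakA z n : slit_plane a b z -> bracket_exists a b W (P n) (P n) ->
  star (frakA a b W P n) z = - (br z (P n) (P n) *m gamma a b W P n).
Proof.
move=> zab ex; rewrite /star frakA_bracket //; last exact: slit_plane_conj.
rewrite -[_^t*]/(adj _) raddfN /=; congr (- _).
by rewrite adjmx_mul adj_gamma adj_bracket.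
Qed.

End OrthogonalPolynomials.

(** Here c = 2 pi i, g = gamma_(n-1), gn = gamma_n. X, Z, T, U are br at (P_n, P_(n-1)), (P_n, P_n),
    (P_(n-1), P_(n-1)), (P_(n-1), P_n); A, B are the values of P_n, P_(n-1), and E, G their [M1]
    forms with 1. A', B' are derivatives and E', G' the [M2] forms. *)
Lemma ladder_block (F : fieldType) (m : nat) (c : F)
    (g gn X Z T U A B E G A' B' E' G' : 'M[F]_m) : c != 0 -> gn \in unitmx ->
  A' = X *m g *m A - Z *m g *m B -> B' = T *m g *m A - U *m g *m B ->
  E' = X *m g *m E - Z *m g *m G -> G' = T *m g *m E - U *m g *m G ->
  block_mx (- - (X *m g)) (- c^-1 *: (invmx gn *m - (gn *m Z)))
    (c *: (- (g *m T) *m g)) (- (g *m U)) *m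
  block_mx A (c^-1 *: E) (- c *: (g *m B)) (- c *: (g *m (c^-1 *: G))) =
  block_mx A' (c^-1 *: E') (- c *: (g *m B')) (- c *: (g *m (c^-1 *: G'))).
Proof.
move=> c0 gnU -> -> -> ->; rewrite mulmx_block opprK mulmxN mulKmx //.
have upper (V V' : 'M[F]_m) :
  X *m g *m V + (- c^-1 *: - Z) *m (- c *: (g *m V')) =
    X *m g *m V - Z *m g *m V'.
  rewrite scalerN scaleNr opprK -scalemxAl -scalemxAr scalerA mulrN mulVf //.
  by rewrite scaleN1r mulmxA.
have lower (V V' : 'M[F]_m) :
    (c *: (- (g *m T) *m g)) *m V + - (g *m U) *m (- c *: (g *m V')) =
    - c *: (g *m (T *m g *m V - U *m g *m V')).
  rewrite mulNmx scalerN mulNmx -scalemxAl mulNmx -scalemxAr scaleNr opprK.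
  by rewrite mulmxBr scaleNr scalerBr opprB addrC !mulmxA.
have combine (V V' : 'M[F]_m) : V *m (c^-1 *: E) - V' *m (c^-1 *: G) =
    c^-1 *: (V *m E - V' *m G) by rewrite -!scalemxAr scalerBr.
by rewrite !upper !lower !combine.
Qed.

Theorem theorem2p17 (R : realType) (N : nat) (a b : \bar R)
    (W : R -> 'M[R]_N.+1) (P : nat -> {poly 'M[R[i]]_N.+1}) (n : nat)
    (ab : (a < b)%E)
    (weightW : is_weight a b W)
    (orthoP : forall k : nat, is_monic_orthogonal a b W k (P k))
    (n_ge1 : (1 <= n)%N)
    (existsAn : bracket_exists a b W (P n) (P n))
    (existsAn1 : bracket_exists a b W (P n.-1) (P n.-1))
    (existsBn : bracket_exists a b W (P n) (P n.-1)) :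
  (forall z : R[i], slit_plane a b z ->
     forall i j : 'I_(N.+1 + N.+1),
       is_derive (z : R[i]^o) 1 (fun w : R[i]^o => Ymx a b W P n w i j : R[i]^o)
         ((ladder_mx a b W P n z *m Ymx a b W P n z) i j)) /\
  (forall z : R[i], slit_plane a b z ->
     gamma a b W P n *m star (frakA a b W P n) z =
     frakA a b W P n z *m gamma a b W P n).
Proof.
split=> z zab; last first.
  (* Both sides are -gamma_n br(P_n, P_n) gamma_n. *)
  by rewrite star_frakA // frakA_bracket // mulmxN mulNmx mulmxA.
suff E : ladder_mx a b W P n z *m Ymx a b W P n z = block_mx
    (mxeval (P n)^`() z)
    ((two_pi_i R)^-1 *: hankel_form (@adjmx R N) (cauchy_moment2 a b W z) (P n) 1)
    (- two_pi_i R *: (gamma a b W P n.-1 *m mxeval (P n.-1)^`() z))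
    (- two_pi_i R *: (gamma a b W P n.-1 *m ((two_pi_i R)^-1 *:
      hankel_form (@adjmx R N) (cauchy_moment2 a b W z) (P n.-1) 1))).
  by rewrite E; exact: is_mxderive_Ymx.
case: n n_ge1 existsAn existsAn1 existsBn => // n _ exA exA1 exB /=.
(* After the case split [n] is the former n - 1. The ladder identities with m = n + 1 give the upper
   block row, those with m = n the lower one. *)
have nn : (n <= n <= n.+1)%N by rewrite leqnn leqnSn.
have nn1 : (n <= n.+1 <= n.+1)%N by rewrite leqnn leqnSn.
rewrite /ladder_mx /Ymx /= (star_frakB ab weightW orthoP zab exB).
rewrite (cauchy_transform_moment ab weightW (P n.+1) zab).
rewrite (cauchy_transform_moment ab weightW (P n) zab).
rewrite (frakA_bracket ab weightW zab exA) (frakA_bracket ab weightW zab exA1).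
rewrite /frakB (bracketE ab weightW zab exB).
apply: ladder_block.
- exact: two_pi_i_neq0.
- exact: (gamma_unit ab weightW orthoP).
- exact: (mxeval_ladder ab weightW orthoP zab nn1).
- exact: (mxeval_ladder ab weightW orthoP zab nn).
- exact: (cauchy_ladder ab weightW orthoP zab nn1).
- exact: (cauchy_ladder ab weightW orthoP zab nn).
Qed.
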